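(* Let $n=2k$ with $k\ge1$, let $V=\mathbb{C}^{n}$ be the standard $\mathrm{GL}(n,\mathbb{C})$-module and let $W=\Lambda(S^2V)$. Then $$H(W^{\mathrm{Sp}(2k)},t)=1+\sum_{\substack{p=2\\ p\text{ even}}}^{n}t^{\frac{p(p+1)}{2}}\left(\sum_{\substack{a_1+\cdots+a_{p/2}\le n-p\\ a_i\text{ even}}}t^{2a_1+4a_2+\cdots+p\,a_{p/2}}\right),$$ where the inner sum runs over tuples of non-negative even integers $a_1,\ldots,a_{p/2}$ with $a_1+\cdots+a_{p/2}\le n-p$.
   Context: $S^2V$ is the second symmetric power of $V$. $\Lambda(S^2V)=\bigoplus_{i\ge0}\Lambda^i(S^2V)$ is the exterior algebra of $S^2V$, with the induced action of $\mathrm{GL}(n,\mathbb{C})$ and hence of the complex symplectic group $\mathrm{Sp}(2k)\subset\mathrm{GL}(2k,\mathbb{C})$. The Hilbert series is $H(\Lambda(S^2V)^{G},t)=\sum_{i\ge0}\dim\bigl(\Lambda^i(S^2V)^{G}\bigr)t^i$. *)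

(* Defs.v *)
From HB Require Import structures.
From mathcomp Require Import all_boot all_order all_algebra.
From mathcomp Require Import boolp reals complex.
From mathcomp Require Import mpoly.

Set Implicit Arguments.
Unset Strict Implicit.
Unset Printing Implicit Defensive.

Import GRing.Theory.

Local Open Scope ring_scope.

(* The exterior algebra of a finite-dimensional vector space U is realized on
   the basis e_S = b_{i_1} /\ ... /\ b_{i_r}, for S = {i_1 < ... < i_r} a set of
   indices of the basis b of U; its universal property is ext_iota_sqr, ext_lift1,
   ext_liftM, ext_lift_iota and ext_lift_uniq below. *)

Definition exterior (K : fieldType) (U : vectType K) : Type :=
  {ffun {set 'I_(\dim {:U})} -> K^o}.

HB.instance Definition _ (K : fieldType) (U : vectType K) :=
  Vector.copy (exterior U) {ffun {set 'I_(\dim {:U})} -> K^o}.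

Section Exterior.

Context (K : fieldType) (U : vectType K).
Local Notation I := 'I_(\dim {:U}).
Implicit Types (i j : I) (S T R : {set I}) (x y z : exterior U) (u : U).

Definition ext_basis S : exterior U := [ffun T => (T == S)%:R].

(* The sign of the shuffle sorting the concatenation of S and T. *)
Definition ext_sign S T : K :=
  if [disjoint S & T] then
    (-1) ^+ #|[set p in setX S T | (p.2 < p.1)%N]| else 0.

Definition ext_mul x y : exterior U :=
  \sum_S \sum_T (x S * y T * ext_sign S T) *: ext_basis (S :|: T).

Lemma ext_decomp x : x = \sum_S x S *: ext_basis S.
Proof.
apply/ffunP => S; rewrite sum_ffunE (bigD1 S) //= !ffunE eqxx.
rewrite [_ *: _]mulr1 big1 ?addr0// => T neqTS.
by rewrite !ffunE eq_sym (negPf neqTS) [_ *: _]mulr0.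
Qed.

Lemma ext_mulDl : left_distributive ext_mul +%R.
Proof.
move=> x y z; rewrite /ext_mul -big_split; apply: eq_bigr => S _ /=.
rewrite -big_split; apply: eq_bigr => T _ /=.
by rewrite ffunE -scalerDl -!mulrDl.
Qed.

Lemma ext_mulDr : right_distributive ext_mul +%R.
Proof.
move=> x y z; rewrite /ext_mul -big_split; apply: eq_bigr => S _ /=.
rewrite -big_split; apply: eq_bigr => T _ /=.
by rewrite ffunE -scalerDl -!mulrDl -mulrDr.
Qed.

Lemma ext_mulZl a x y : ext_mul (a *: x) y = a *: ext_mul x y.
Proof.
rewrite /ext_mul scaler_sumr; apply: eq_bigr => S _.
rewrite scaler_sumr; apply: eq_bigr => T _.
by rewrite ffunE scalerA -!mulrA.
Qed.

Lemma ext_mulZr a x y : ext_mul x (a *: y) = a *: ext_mul x y.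
Proof.
rewrite /ext_mul scaler_sumr; apply: eq_bigr => S _.
rewrite scaler_sumr; apply: eq_bigr => T _.
by rewrite ffunE scalerA -!mulrA; congr (_ *: _); rewrite mulrCA.
Qed.

Lemma ext_mul0l y : ext_mul 0 y = 0.
Proof. by have := ext_mulZl 0 0 y; rewrite !scale0r. Qed.

Lemma ext_mul0r x : ext_mul x 0 = 0.
Proof. by have := ext_mulZr 0 x 0; rewrite !scale0r. Qed.

Lemma ext_mul_suml (J : Type) (r : seq J) (P : pred J) F y :
  ext_mul (\sum_(j <- r | P j) F j) y = \sum_(j <- r | P j) ext_mul (F j) y.
Proof.
by apply: (big_morph (ext_mul^~ y) (fun x x' => ext_mulDl x x' y)); apply: ext_mul0l.
Qed.

Lemma ext_mul_sumr (J : Type) (r : seq J) (P : pred J) F x :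
  ext_mul x (\sum_(j <- r | P j) F j) = \sum_(j <- r | P j) ext_mul x (F j).
Proof.
by apply: (big_morph (ext_mul x) (ext_mulDr x)); apply: ext_mul0r.
Qed.

Lemma ext_mul_basis S T :
  ext_mul (ext_basis S) (ext_basis T) = ext_sign S T *: ext_basis (S :|: T).
Proof.
rewrite /ext_mul (bigD1 S) //= (bigD1 T) //= !ffunE !eqxx !mul1r.
rewrite !big1 ?addr0// => S' neqS'; last first.
  by rewrite ffunE (negPf neqS') mulr0 mul0r scale0r.
by rewrite big1// => T' _; rewrite ffunE (negPf neqS') !mul0r scale0r.
Qed.

Lemma ext_sign_cocycle S T R :
  ext_sign S T * ext_sign (S :|: T) R = ext_sign T R * ext_sign S (T :|: R).
Proof.
rewrite /ext_sign !disjoints_subset setCU subsetI -!disjoints_subset.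
rewrite (disjoint_sym (S :|: T) R) !disjoints_subset setCU subsetI.
rewrite -!disjoints_subset [[disjoint R & S]]disjoint_sym.
rewrite [[disjoint R & T]]disjoint_sym.
case: (boolP [disjoint S & T]) => [dST|_]; last by rewrite !mul0r mulr0.
case: (boolP [disjoint T & R]) => [dTR|_]; last by rewrite andbF mulr0 mul0r.
case: (boolP [disjoint S & R]) => [dSR|_]; last by rewrite !mulr0.
rewrite /= -!exprD; congr (_ ^+ _).
set f := fun A B : {set I} => [set p in setX A B | (p.2 < p.1)%N].
have fUl (A A' B : {set I}) : [disjoint A & A'] -> #|f (A :|: A') B| = (#|f A B| + #|f A' B|)%N.
  move=> dA; have -> : f (A :|: A') B = f A B :|: f A' B.
    by apply/setP=> -[i j]; rewrite !inE /= !andb_orl.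
  rewrite cardsU [_ :&: _](_ : _ = set0) ?cards0 ?subn0//.
  apply/setP=> -[i j]; rewrite !inE /=; apply/negP.
  case/andP=> /andP[/andP[iA _] _] /andP[/andP[iA' _] _].
  by move/pred0P: dA => /(_ i) /=; rewrite iA iA'.
have fUr (A B B' : {set I}) : [disjoint B & B'] -> #|f A (B :|: B')| = (#|f A B| + #|f A B'|)%N.
  move=> dB; have -> : f A (B :|: B') = f A B :|: f A B'.
    by apply/setP=> -[i j]; rewrite !inE /= andb_orr !andb_orl.
  rewrite cardsU [_ :&: _](_ : _ = set0) ?cards0 ?subn0//.
  apply/setP=> -[i j]; rewrite !inE /=; apply/negP.
  case/andP=> /andP[/andP[_ jB] _] /andP[/andP[_ jB'] _].
  by move/pred0P: dB => /(_ j) /=; rewrite jB jB'.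
by rewrite -/(f S T) -/(f _ R) -/(f T R) -/(f S _) fUl// fUr// addnA addnC addnA.
Qed.

Lemma ext_mul_decl x y : ext_mul x y = \sum_S x S *: ext_mul (ext_basis S) y.
Proof.
rewrite {1}(ext_decomp x) ext_mul_suml.
by apply: eq_bigr => S _; rewrite ext_mulZl.
Qed.

Lemma ext_mul_decr x y : ext_mul x y = \sum_S y S *: ext_mul x (ext_basis S).
Proof.
rewrite {1}(ext_decomp y) ext_mul_sumr.
by apply: eq_bigr => S _; rewrite ext_mulZr.
Qed.

Lemma ext_mulA : associative ext_mul.
Proof.
move=> x y z; rewrite (ext_mul_decl x (ext_mul y z)) (ext_mul_decl x y).
rewrite ext_mul_suml; apply: eq_bigr => S _; rewrite ext_mulZl; congr (_ *: _).
rewrite (ext_mul_decl y z) (ext_mul_decr (ext_basis S) y).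
rewrite ext_mul_suml ext_mul_sumr; apply: eq_bigr => T _.
rewrite ext_mulZl ext_mulZr; congr (_ *: _).
rewrite (ext_mul_decr (ext_basis T) z).
rewrite (ext_mul_decr (ext_mul (ext_basis S) (ext_basis T)) z) ext_mul_sumr.
apply: eq_bigr => R _; rewrite ext_mulZr; congr (_ *: _).
rewrite !ext_mul_basis ext_mulZl ext_mulZr !ext_mul_basis !scalerA setUA.
by rewrite ext_sign_cocycle.
Qed.

Lemma ext_sign0l S : ext_sign set0 S = 1.
Proof.
rewrite /ext_sign disjoints_subset sub0set [X in #|pred_of_set X|](_ : _ = set0) ?cards0//.
by apply/setP=> -[i j]; rewrite !inE.
Qed.

Lemma ext_sign0r S : ext_sign S set0 = 1.
Proof.
rewrite /ext_sign disjoint_sym disjoints_subset sub0set.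
rewrite [X in #|pred_of_set X|](_ : _ = set0) ?cards0//.
by apply/setP=> -[i j]; rewrite !inE andbF.
Qed.

Lemma ext_mul1l : left_id (ext_basis set0) ext_mul.
Proof.
move=> x; rewrite ext_mul_decr [RHS]ext_decomp; apply: eq_bigr => S _.
by rewrite ext_mul_basis ext_sign0l set0U scale1r.
Qed.

Lemma ext_mul1r : right_id (ext_basis set0) ext_mul.
Proof.
move=> x; rewrite ext_mul_decl [RHS]ext_decomp; apply: eq_bigr => S _.
by rewrite ext_mul_basis ext_sign0r setU0 scale1r.
Qed.

Lemma ext_1neq0 : ext_basis set0 != 0.
Proof.
by apply/eqP => /ffunP /(_ set0) /eqP; rewrite !ffunE eqxx oner_eq0.
Qed.

HB.instance Definition _ := GRing.Zmodule_isNzRing.Build (exterior U)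
  ext_mulA ext_mul1l ext_mul1r ext_mulDl ext_mulDr ext_1neq0.

Lemma ext_scalerAl a x y : a *: (x * y) = (a *: x) * y.
Proof. exact/esym/ext_mulZl. Qed.

HB.instance Definition _ :=
  GRing.Lmodule_isLalgebra.Build K (exterior U) ext_scalerAl.

Lemma ext_scalerAr a x y : a *: (x * y) = x * (a *: y).
Proof. exact/esym/ext_mulZr. Qed.

HB.instance Definition _ :=
  GRing.Lalgebra_isAlgebra.Build K (exterior U) ext_scalerAr.

Definition ext_iota (u : U) : exterior U :=
  \sum_i coord (vbasis {:U}) i u *: ext_basis [set i].

Lemma ext_iota_is_linear : linear ext_iota.
Proof.
move=> a u v; rewrite /ext_iota scaler_sumr -big_split; apply: eq_bigr => i _.
by rewrite linearP scalerDl scalerA.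
Qed.

HB.instance Definition _ :=
  GRing.isLinear.Build K U (exterior U) _ ext_iota ext_iota_is_linear.

Lemma ext_basisM S T :
  ext_basis S * ext_basis T = ext_sign S T *: ext_basis (S :|: T).
Proof. exact: ext_mul_basis. Qed.

Lemma ext_sign11 i j :
  ext_sign [set i] [set j] = if i == j then 0 else (-1) ^+ (j < i)%N.
Proof.
rewrite /ext_sign disjoints1 inE; case: eqVneq => //= neqij.
congr (_ ^+ _); rewrite [X in #|pred_of_set X|](_ : _ = if (j < i)%N then [set (i, j)] else set0).
  by case: ifP; rewrite ?cards1 ?cards0.
apply/setP=> -[i' j']; rewrite !inE /=.
case: ifP => ji; rewrite !inE /= ?xpair_eqE.
  by case: eqVneq => [->|] //=; case: eqVneq => [->|].
by case: eqVneq => [->|] //=; case: eqVneq => [->|].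
Qed.

Lemma ext_iota_sqr u : ext_iota u * ext_iota u = 0.
Proof.
have swapK : cancel (fun p : I * I => (p.2, p.1)) (fun p => (p.2, p.1)) by case.
rewrite /ext_iota mulr_suml.
under eq_bigr do rewrite mulr_sumr.
rewrite pair_bigA (bigID (fun p : I * I => p.1 < p.2)%N) /=.
rewrite [X in _ + X](bigID (fun p : I * I => p.1 == p.2)) /= [X in _ + (X + _)]big1; last first.
  move=> -[i j] /= /andP[_ /eqP->].
  by rewrite -scalerAl -scalerAr ext_basisM ext_sign11 eqxx scale0r !scaler0.
rewrite add0r [X in _ + X](reindex_inj (can_inj swapK)) /=.
rewrite [X in _ + X](eq_bigl (fun p : I * I => p.1 < p.2)%N); last first.
  move=> -[i j] /=; rewrite -leqNgt leq_eqVlt -(inj_eq val_inj) eq_sym /=.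
  by case: ltngtP.
rewrite -big_split big1 //= => -[i j] /= ltij.
rewrite -!scalerAl -!scalerAr !ext_basisM !ext_sign11 setUC.
rewrite -!(inj_eq val_inj) /= ltij (ltn_eqF ltij) (gtn_eqF ltij) ltnNge (ltnW ltij).
by rewrite expr1 expr0 !scalerA -scalerDl mulr1 mulrN1 mulrC subrr scale0r.
Qed.

Lemma ext_sign_lt i T : (forall j, j \in T -> (i < j)%N) -> ext_sign [set i] T = 1.
Proof.
move=> ltiT; rewrite /ext_sign disjoints1 ifT; last first.
  by apply/negP => /ltiT; rewrite ltnn.
rewrite [X in #|pred_of_set X|](_ : _ = set0) ?cards0//.
apply/setP=> -[i' j]; rewrite !inE /=; apply/negP => /andP[/andP[/eqP-> /ltiT]].
by move=> /ltnW; rewrite leqNgt => /negPf->.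
Qed.

Lemma ext_basisU1 i T : (forall j, j \in T -> (i < j)%N) ->
  ext_basis (i |: T) = ext_basis [set i] * ext_basis T.
Proof. by move=> ltiT; rewrite ext_basisM ext_sign_lt// scale1r. Qed.

Lemma set_ord_ind (P : {set I} -> Prop) : P set0 ->
  (forall i T, (forall j, j \in T -> (i < j)%N) -> P T -> P (i |: T)) ->
  forall T, P T.
Proof.
move=> P0 PU T; have [n] := ubnP #|T|; elim: n T => // n IHn T leTn.
have [->//|[i0 Ti0]] := set_0Vmem T.
have [i Ti imin] := arg_minnP (fun i : I => val i) Ti0.
rewrite -(setD1K Ti); apply: PU => [j|].
  by rewrite !inE ltn_neqAle eq_sym -(inj_eq val_inj) => /andP[-> /imin].
by apply: IHn; move: leTn; rewrite (cardsD1 i T) [i \in T]Ti.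
Qed.

Lemma big_setU1_ord (A : pzRingType) (F : I -> A) i T :
  (forall j, j \in T -> (i < j)%N) ->
  \prod_(j <- enum (i |: T)) F j = F i * \prod_(j <- enum T) F j.
Proof.
move=> ltiT.
transitivity (\prod_(j <- i :: enum T) F j); last by rewrite big_cons.
congr bigop.
pose lto := fun a b : I => (a < b)%N.
have lto_tr : transitive lto by move=> a b c; apply: ltn_trans.
have sorted_enum S : sorted lto (enum S).
  have -> : enum S = filter (mem S) (enum I) by rewrite enumT.
  apply: sorted_filter => //.
  by have := iota_ltn_sorted 0 (\dim {:U}); rewrite -val_enum_ord sorted_map.
apply: (irr_sorted_eq lto_tr) => //.
- by move=> a; rewrite /lto ltnn.
- rewrite /= path_min_sorted ?sorted_enum//.
  by apply/allP => j; rewrite mem_enum => /ltiT.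
- by move=> j; rewrite inE !mem_enum !inE.
Qed.

Lemma ext_iota_basis i : ext_iota (vbasis {:U})`_i = ext_basis [set i].
Proof.
rewrite /ext_iota (bigD1 i) //= big1 ?addr0.
  by rewrite coord_free ?eqxx ?scale1r// (basis_free (vbasisP _)).
move=> j neqji; rewrite coord_free ?(basis_free (vbasisP _))//.
by rewrite eq_sym (negPf neqji) scale0r.
Qed.

Lemma ext_basisE S : ext_basis S = \prod_(i <- enum S) ext_iota (vbasis {:U})`_i.
Proof.
elim/set_ord_ind: S => [|i T ltiT IHT]; first by rewrite enum_set0 big_nil.
by rewrite big_setU1_ord// ext_basisU1// ext_iota_basis IHT.
Qed.

(* An algebra morphism when f is linear and f u * f u = 0 for all u. *)
Definition ext_lift (A : algType K) (f : U -> A) (x : exterior U) : A :=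
  \sum_S x S *: \prod_(i <- enum S) f (vbasis {:U})`_i.

Lemma ext_lift_is_linear (A : algType K) (f : U -> A) : linear (ext_lift f).
Proof.
move=> a x y; rewrite /ext_lift scaler_sumr -big_split; apply: eq_bigr => S _.
by rewrite !ffunE scalerDl scalerA.
Qed.

HB.instance Definition _ (A : algType K) (f : U -> A) :=
  GRing.isLinear.Build K (exterior U) A _ (ext_lift f) (ext_lift_is_linear f).

Lemma ext_lift_basis (A : algType K) (f : U -> A) S :
  ext_lift f (ext_basis S) = \prod_(i <- enum S) f (vbasis {:U})`_i.
Proof.
rewrite /ext_lift (bigD1 S) //= ffunE eqxx scale1r [X in _ + X]big1 ?addr0// => T.
by move=> neqTS; rewrite ffunE (negPf neqTS) scale0r.
Qed.

Lemma ext_lift1 (A : algType K) (f : U -> A) : ext_lift f 1 = 1.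
Proof. by rewrite ext_lift_basis enum_set0 big_nil. Qed.

Lemma ext_lift_iota (A : algType K) (f : {linear U -> A}) u :
  ext_lift f (ext_iota u) = f u.
Proof.
rewrite [X in _ = f X](coord_vbasis (memvf u)) /ext_iota !linear_sum; apply: eq_bigr => i _.
by rewrite !linearZ /= ext_lift_basis enum_set1 big_seq1.
Qed.

Lemma ext_liftM (A : algType K) (f : {linear U -> A}) :
  (forall u, f u * f u = 0) ->
  forall x y, ext_lift f (x * y) = ext_lift f x * ext_lift f y.
Proof.
move=> fsqr; have fanti u v : f u * f v = - (f v * f u).
  apply/eqP; rewrite -addr_eq0; have := fsqr (u + v).
  by rewrite linearD mulrDl !mulrDr !fsqr add0r addr0 => ->.
set b := fun i : I => (vbasis {:U})`_i.
have lift_lt i T : (forall j, j \in T -> (i < j)%N) ->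
    ext_lift f (ext_basis [set i] * ext_basis T) =
    f (b i) * ext_lift f (ext_basis T).
  by move=> ltiT; rewrite -ext_basisU1// !ext_lift_basis big_setU1_ord.
have lift1 i T : ext_lift f (ext_basis [set i] * ext_basis T) =
    f (b i) * ext_lift f (ext_basis T).
  elim/set_ord_ind: T i => [|j T ltjT IHT] i.
    by rewrite lift_lt// => j; rewrite inE.
  case: (ltngtP i j) => [ltij|ltji|/val_inj eqij].
  - apply: lift_lt => l; rewrite !inE => /predU1P[->//|/ltjT].
    exact: ltn_trans.
  - rewrite ext_basisU1// mulrA.
    have -> : ext_basis [set i] * ext_basis [set j] =
        - (ext_basis [set j] * ext_basis [set i]).
      rewrite !ext_basisM !ext_sign11 -!(inj_eq val_inj) /= setUC.
      by rewrite (gtn_eqF ltji) (ltn_eqF ltji) ltji ltnNge (ltnW ltji) scaleN1r scale1r.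
    rewrite mulNr -mulrA linearN /= [in RHS]lift_lt// [RHS]mulrA [in RHS]fanti.
    rewrite [RHS]mulNr -[in RHS]mulrA -IHT; congr (- _).
    rewrite ext_basisM -scalerAr !linearZ /= lift_lt ?scalerAr// => l.
    by rewrite !inE => /predU1P[->//|/ltjT].
  - rewrite -eqij ext_basisU1 ?eqij// mulrA ext_basisM ext_sign11 eqxx scale0r.
    by rewrite mul0r linear0 lift_lt// mulrA fsqr mul0r.
have liftB S T : ext_lift f (ext_basis S * ext_basis T) =
    ext_lift f (ext_basis S) * ext_lift f (ext_basis T).
  elim/set_ord_ind: S => [|i S ltiS IHS].
    by rewrite [ext_lift f (ext_basis set0)]ext_lift1 !mul1r.
  rewrite ext_basisU1// -mulrA lift_lt// -mulrA -IHS ext_basisM -scalerAr.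
  by rewrite !linearZ /= lift1 scalerAr.
move=> x y; rewrite (ext_decomp x) mulr_suml !linear_sum mulr_suml.
apply: eq_bigr => S _; rewrite -scalerAl !linearZ /= -scalerAl; congr (_ *: _).
rewrite (ext_decomp y) mulr_sumr !linear_sum mulr_sumr.
by apply: eq_bigr => T _; rewrite -scalerAr !linearZ /= -scalerAr liftB.
Qed.

Lemma ext_lift_uniq (A : algType K) (F : {lrmorphism exterior U -> A}) x :
  F x = ext_lift (F \o ext_iota) x.
Proof.
rewrite {1}(ext_decomp x) linear_sum; apply: eq_bigr => S _.
by rewrite linearZ ext_basisE rmorph_prod.
Qed.

Definition ext_power (d : nat) : {vspace exterior U} :=
  <<[seq ext_basis J | J : {set I} <- enum [set J : {set I} | #|J| == d]]>>%VS.

Lemma ext_powerP d x :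
  (x \in ext_power d) <-> (forall S, #|S| != d -> x S = 0).
Proof.
split=> [xd S neqSd|xd].
  move: xd; rewrite /ext_power; set X := map _ _ => xd.
  rewrite (coord_span (X := in_tuple X) xd).
  rewrite sum_ffunE big1// => i _; rewrite ffunE.
  have : (in_tuple X)`_i \in X by apply: mem_nth.
  case/mapP => J; rewrite mem_enum inE => /eqP Jd ->; rewrite ffunE.
  by case: (eqVneq S J) neqSd => [->|_ _]; [rewrite Jd eqxx | apply: mulr0].
rewrite (ext_decomp x); apply: memv_suml => S _.
have [Sd|/xd->] := eqVneq #|S| d; last by rewrite scale0r mem0v.
by apply/memvZ/memv_span/map_f; rewrite mem_enum inE Sd.
Qed.

Lemma ext_power_iota d (u : 'I_d -> U) :
  \prod_(i < d) ext_iota (u i) \in ext_power d.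
Proof.
elim: d u => [|d IHd] u.
  rewrite big_ord0; apply/ext_powerP => S; rewrite cards_eq0 => S0.
  by rewrite ffunE (negPf S0).
rewrite big_ord_recl; have /ext_powerP xd := IHd (fun i : 'I_d => u (lift ord0 i)).
rewrite [X in _ * X]ext_decomp /ext_iota mulr_suml.
apply: memv_suml => i _; rewrite mulr_sumr; apply: memv_suml => S _.
rewrite -scalerAl -scalerAr ext_basisM /ext_sign.
have [Sd|/xd->] := eqVneq #|S| d; last by rewrite scale0r scaler0 mem0v.
case: ifP => [|_]; last by rewrite scale0r !scaler0 mem0v.
rewrite disjoints1 => iS; do 3!apply: memvZ; apply/memv_span/map_f.
by rewrite mem_enum inE cardsU1 iS Sd.
Qed.

End Exterior.

Definition ext_map (K : fieldType) (U U' : vectType K) (f : U -> U') :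
  exterior U -> exterior U' := ext_lift (@ext_iota K U' \o f).

HB.instance Definition _ (K : fieldType) (U U' : vectType K) (f : U -> U') :=
  GRing.Linear.copy (ext_map f) (ext_lift (@ext_iota K U' \o f)).

Section ExtMap.

Context (K : fieldType) (U U' : vectType K) (f : {linear U -> U'}).

Lemma ext_map_iota u : ext_map f (ext_iota u) = ext_iota (f u).
Proof. exact: ext_lift_iota. Qed.

Lemma ext_map1 : ext_map f 1 = 1.
Proof. exact: ext_lift1. Qed.

Lemma ext_mapM x y : ext_map f (x * y) = ext_map f x * ext_map f y.
Proof. by apply: ext_liftM => u; apply: ext_iota_sqr. Qed.

End ExtMap.

(* V = K^n has the basis 'X_0, ..., 'X_(n-1), its symmetric algebra is
   {mpoly K[n]}, and the second symmetric power is the component of degree 2.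
   The library makes dhomog n K d a vectType only for n a successor. *)
Definition sym2 (K : fieldType) (n : nat) : Type := dhomog n K 2.

HB.instance Definition _ (K : fieldType) (n : nat) :=
  GRing.Lmodule.copy (sym2 K n) (dhomog n K 2).

Lemma sym2_vecaxiom (K : fieldType) (n : nat) :
  vector_axiom 'C(n.+1, 2) (sym2 K n).
Proof.
case: n => [|n]; last exact: dhomog_vecaxiom.
have sym2_0 (p : sym2 K 0) : p = 0.
  apply/val_inj => /=; apply/mpolyP => m; rewrite mcoeff0.
  apply: (dhomog_nemf_coeff (dhomog_is_dhomog p)).
  by rewrite /= mdegE big_ord0.
exists (fun=> 0) => [a p q|]; first by rewrite scaler0 addr0.
exists (fun=> 0) => [p|v]; first by rewrite [RHS]sym2_0.
by apply/rowP => -[].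
Qed.

HB.instance Definition _ (K : fieldType) (n : nat) :=
  Lmodule_hasFinDim.Build K (sym2 K n) (sym2_vecaxiom K n).

Section SymAction.

Context (K : fieldType) (n : nat).
Implicit Types (g h : 'M[K]_n).

(* The image of the j-th basis vector under g is the j-th column of g. *)
Definition lin_subst g : n.-tuple {mpoly K[n]} :=
  [tuple \sum_i g i j *: 'X_i | j < n].

Lemma lin_subst_homog g d (p : {mpoly K[n]}) :
  p \is d.-homog -> p \mPo lin_subst g \is d.-homog.
Proof.
move=> /dhomogP hp; rewrite comp_mpolyE big_seq; apply: rpred_sum => m /hp <-.
rewrite /=; apply: dhomogZ; rewrite mdegE.
elim/big_ind2: _ => [|p1 d1 p2 d2 H1 H2|i _]; first exact: dhomog1.
  exact: dhomogM.
rewrite -[X in X.-homog]mul1n; apply: dhomogMn; rewrite tnth_mktuple.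
by apply: rpred_sum => j _; apply: dhomogZ; rewrite dhomogX /= mdeg1.
Qed.

Definition sym2_act g (p : sym2 K n) : sym2 K n :=
  DHomog (lin_subst_homog g (valP p)).

Lemma sym2_act_is_linear g : linear (sym2_act g).
Proof.
move=> a p q; apply/val_inj; rewrite /= comp_mpolyD comp_mpolyZ.
by [].
Qed.

HB.instance Definition _ g := GRing.isLinear.Build K (sym2 K n) (sym2 K n) _
  (sym2_act g) (sym2_act_is_linear g).

Definition ext_sym2_act g : exterior (sym2 K n) -> exterior (sym2 K n) :=
  ext_map (sym2_act g).

HB.instance Definition _ g :=
  GRing.Linear.copy (ext_sym2_act g) (ext_map (sym2_act g)).

Implicit Types (G : {pred 'M[K]_n}).

Definition is_invariant G (w : exterior (sym2 K n)) : Prop :=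
  forall g, g \in G -> ext_sym2_act g w = w.

Lemma invariants_exist G d : exists X : {vspace exterior (sym2 K n)},
  forall w, w \in X <-> w \in ext_power (sym2 K n) d /\ is_invariant G w.
Proof.
pose P w := w \in ext_power (sym2 K n) d /\ is_invariant G w.
pose Q m := `[< exists2 X : {vspace exterior (sym2 K n)},
  (forall w, w \in X -> P w) & \dim X = m >].
have Q0 : exists m, Q m.
  exists 0; apply/asboolP; exists 0%VS; last exact: dimv0.
  move=> w; rewrite memv0 => /eqP->; split; first exact: mem0v.
  by move=> g _; apply: linear0.
have Qle m : Q m -> (m <= \dim {:exterior (sym2 K n)})%N.
  by case/asboolP => X _ <-; apply/dimvS/subvf.
case: (ex_maxnP Q0 Qle) => m /asboolP[X XP dX] mmax.
exists X => w; split=> [/XP//|Pw].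
have /mmax : Q (\dim (X + <[w]>)).
  apply/asboolP; exists (X + <[w]>)%VS => // y /memv_addP[v /XP[vd vG]].
  case=> _ /vlineP[a ->] ->; case: Pw => wd wG; split.
    by apply: memvD => //; apply: memvZ.
  by move=> g gG; rewrite linearD linearZ /= vG// wG.
rewrite -dX => leX; have /eqP -> : X == (X + <[w]>)%VS.
  by rewrite eqEdim addvSl.
by apply: (subvP (addvSr _ _)); apply: memv_line.
Qed.

Definition invariants G d : {vspace exterior (sym2 K n)} :=
  projT1 (cid (invariants_exist G d)).

Lemma invariantsP G d w :
  w \in invariants G d <-> w \in ext_power (sym2 K n) d /\ is_invariant G w.
Proof. by rewrite /invariants; case: cid. Qed.

(* The series is a polynomial, as exterior powers beyond the dimension vanish. *)
Definition hilbert_series G : {poly int} :=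
  \poly_(d < (\dim {:sym2 K n}).+1) (\dim (invariants G d))%:Z.

Lemma coef_hilbert_series G d :
  (hilbert_series G)`_d = (\dim (invariants G d))%:Z.
Proof.
rewrite coef_poly; case: ltnP => // ltd.
suff -> : invariants G d = 0%VS by rewrite dimv0.
apply/eqP; rewrite -subv0; apply/subvP => w /invariantsP[/ext_powerP wd _].
rewrite memv0; apply/eqP/ffunP => S; rewrite ffunE; apply: wd.
by rewrite neq_ltn (leq_ltn_trans (max_card _))// card_ord.
Qed.

End SymAction.

Definition symplectic_form (K : fieldType) (k : nat) : 'M[K]_(k + k) :=
  block_mx 0 1%:M (- 1%:M) 0.

Definition Sp (K : fieldType) (k : nat) : {pred 'M[K]_(k + k)} :=
  [pred g | (g \in unitmx) &&
            (g^T *m symplectic_form K k *m g == symplectic_form K k)].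

Arguments symplectic_form : clear implicits.
Arguments Sp : clear implicits.

(* Main.v *)
Require Import Defs.
From HB Require Import structures.
From mathcomp Require Import all_boot all_order all_algebra.
From mathcomp Require Import perm ring zify.
From mathcomp Require Import boolp reals complex.
From mathcomp Require Import mpoly.

Set Implicit Arguments.
Unset Strict Implicit.
Unset Printing Implicit Defensive.

Import Order.TTheory GRing.Theory Num.Theory.

Local Open Scope ring_scope.

(** Let V have dimension n = 2k, let W be the exterior algebra of S^2 V, and let
    x be the symmetric n x n matrix over W whose entry x_ab is the generator
    X_a X_b.  Since S^2 V is the adjoint representation of Sp(V), the theorem is
    an instance of a classical fact: W^Sp is an exterior algebra on generators
    of degrees 3, 7, ..., 4k-1, so its series is the product of the
    1 + t^(4i+3) for i < k; the q-binomial theorem expands this product into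
    the stated sum.

    The generators are traces of powers of Y = x J, where J is the symplectic
    form.

    Spanning.  An invariant of degree d is lifted to an invariant tensor with 2d
    slots (invariant_lift), which is then killed by the Lie algebra sp.  The
    first fundamental theorem (fft_sp) says that such tensors come from pairing
    off the slots by J.  Its proof is a Casimir computation: for T with m slots
    killed by sp, m T + sum_ab E_ba E_ab T is a sum of terms J_ij (c_ij T),
    where c_ij T, the contraction of T in the slots i and j, is again killed by
    sp and has two slots less.  The operator on the left is invertible because
    E_ba is the adjoint of E_ab, and it lies in the span of the permutations of
    the slots, so T itself is obtained by pairings.
    In W, pairing two slots by J joins products x J x J ... x into longer ones
    or closes one of them into a trace (arc_eval_invariant), so W^Sp is
    generated by the traces of the powers Y^m.

    Which traces survive.  The entries of Y anticommute.  Cyclic rotation kills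
    the trace of Y^m for m even, and reversal, which uses that x is symmetric
    and J skew, kills it for m = 1 mod 4.  Moreover Y^2 has entries in the
    commutative even part of W and all its powers have trace 0, so
    (Y^2)^n = 0 by Newton and Cayley-Hamilton (arc_mx_vanish; this is Rosset's
    argument for the Amitsur-Levitzki theorem).  Only the exponents 3, 7, ...,
    4k-1 remain.  These traces have odd degree, so W^Sp is spanned by the
    products of distinct ones.

    Independence.  The top form of W is invariant, hence in the span of these
    products.  Its degree dim S^2 V = k(2k+1) is the sum of all the degrees 3,
    7, ..., 4k-1, so it is a multiple of the product of all the generators,
    which is thus nonzero (prim_full_neq0); multiplying a linear relation by
    complementary products then shows that it is trivial (set_prod_free).

    Throughout, invariance under symplectic transvections is all that the
    spanning part assumes.  This lets it apply to the top form, on which a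
    transvection acts by 1 because it is conjugate in GL(V) to its square. *)

(** * Subspaces, orthogonal projection *)

Lemma linear_pred_vspace (K : fieldType) (E : vectType K) (P : E -> Prop) :
    P 0 -> (forall c x y, P x -> P y -> P (c *: x + y)) ->
  exists X : {vspace E}, forall x, x \in X <-> P x.
Proof.
move=> P0 PL.
pose Q m := `[< exists2 X : {vspace E},
  (forall x, x \in X -> P x) & \dim X = m >].
have Q0 : exists m, Q m.
  exists 0; apply/asboolP; exists 0%VS; last exact: dimv0.
  by move=> x; rewrite memv0 => /eqP->.
have Qle m : Q m -> (m <= \dim {:E})%N.
  by case/asboolP => X _ <-; apply/dimvS/subvf.
case: (ex_maxnP Q0 Qle) => m /asboolP[X XP dX] mmax.
exists X => x; split=> [/XP//|Px].
have /mmax : Q (\dim (X + <[x]>)).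
  apply/asboolP; exists (X + <[x]>)%VS => // y /memv_addP[v /XP Pv].
  by case=> _ /vlineP[a ->] ->; rewrite addrC; apply: PL.
rewrite -dX => leX; have /eqP -> : X == (X + <[x]>)%VS by rewrite eqEdim addvSl.
by apply: (subvP (addvSr _ _)); apply: memv_line.
Qed.

(** By finiteness of dimension the injective map L sends the subspace M onto
    itself, so the only preimage of an element of M lies in M. *)
Lemma injective_reflects_stable (K : fieldType) (X : finType)
    (M : (X -> K) -> Prop) (L : (X -> K) -> (X -> K)) :
    M (fun=> 0) ->
    (forall c T T', M T -> M T' -> M (fun w => c * T w + T' w)) ->
    (forall c T T' w, L (fun w => c * T w + T' w) w = c * L T w + L T' w) ->
    (forall T, (forall w, L T w = 0) -> forall w, T w = 0) ->
    (forall T, M T -> M (L T)) ->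
  forall T, M (L T) -> M T.
Proof.
move=> M0 ML LL Linj LM T MLT.
pose E := {ffun X -> K^o}.
pose f (x : E) : E := [ffun w => L x w].
have f_lin : linear f.
  move=> c x y; apply/ffunP=> w; rewrite !ffunE -[RHS]LL.
  by congr L; apply/funext => w'; rewrite !ffunE.
pose fL := GRing.isLinear.Build K E E _ f f_lin.
pose g : {linear E -> E} := HB.pack f fL.
have [V VP] : exists V : {vspace E}, forall x, x \in V <-> M (fun w => x w).
  apply: linear_pred_vspace => [|c x y Mx My].
    by move: M0; congr M; apply/funext => w; rewrite ffunE.
  by move: (ML c _ _ Mx My); congr M; apply/funext => w; rewrite !ffunE.
have gV : (linfun g @: V <= V)%VS.
  apply/subvP => _ /memv_imgP[x /VP Mx ->]; apply/VP; rewrite lfunE /=.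
  by move: (LM _ Mx); congr M; apply/funext => w; rewrite ffunE.
have ker0 : lker (linfun g) == 0%VS.
  rewrite -subv0; apply/subvP => x; rewrite memv_ker lfunE /= => /eqP gx0.
  rewrite memv0; apply/eqP/ffunP => w; rewrite ffunE; apply: Linj => w'.
  by move/ffunP/(_ w'): gx0; rewrite !ffunE.
have gVE : (linfun g @: V)%VS = V.
  by apply/eqP; rewrite eqEdim gV /= limg_dim_eq ?(eqP ker0) ?capv0 ?leqnn ?andbT.
pose t : E := [ffun w => T w].
have tE : (fun w => t w) = T by apply/funext => w; rewrite ffunE.
have : g t \in V.
  apply/VP; move: MLT; congr M; apply/funext => w.
  by rewrite ffunE; congr L; apply/funext => w'; rewrite ffunE.
rewrite -[in X in X -> _]gVE => /memv_imgP[x xV]; rewrite lfunE => /= gxt.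
have gxt' : linfun g t = linfun g x by rewrite !lfunE.
have /lker0P finj := ker0.
by move: xV; rewrite -(finj _ _ gxt') => /VP; rewrite tE.
Qed.

(** Pairing with a basis of the subspace is an injective map from the subspace
    to row vectors of the same length, hence it attains the values of T. *)
Lemma orthogonal_projection (C : numClosedFieldType) (X : finType)
    (P : (X -> C) -> Prop) :
    P (fun=> 0) -> (forall c T T', P T -> P T' -> P (fun w => c * T w + T' w)) ->
  forall T, exists2 Z, P Z & forall Z', P Z' -> \sum_w (T w - Z w) * (Z' w)^* = 0.
Proof.
move=> P0 PL T; pose E := {ffun X -> C^o}.
have [V VP] : exists V : {vspace E}, forall v, v \in V <-> P (fun w => v w).
  apply: linear_pred_vspace => [|c v v' Pv Pv'].
    by move: P0; congr P; apply/funext => w; rewrite ffunE.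
  by move: (PL c _ _ Pv Pv'); congr P; apply/funext => w; rewrite !ffunE.
pose b i : E := (vbasis V)`_i.
pose f (v : E) : 'rV[C]_(\dim V) := \row_i \sum_w v w * (b i w)^*.
have f_lin : linear f.
  move=> c u v; apply/rowP => i; rewrite !mxE mulr_sumr -big_split.
  by apply: eq_bigr => w _; rewrite !ffunE mulrDl -mulrA.
pose fL := GRing.isLinear.Build C E 'rV[C]_(\dim V) _ f f_lin.
pose g : {linear E -> 'rV[C]_(\dim V)} := HB.pack f fL.
have fV u v : v \in V -> f u = 0 -> \sum_w u w * (v w)^* = 0.
  move=> /coord_vbasis -> fu0.
  under eq_bigr => w _ do rewrite sum_ffunE rmorph_sum mulr_sumr.
  rewrite exchange_big big1 //= => i _.
  have := congr1 (fun r : 'rV__ => r 0 i) fu0; rewrite !mxE => fu0i.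
  transitivity ((coord (vbasis V) i v)^* * \sum_w u w * (b i w)^*); last first.
    by rewrite fu0i mulr0.
  rewrite mulr_sumr; apply: eq_bigr => w _.
  by rewrite ffunE rmorphM mulrCA.
have ker0 : (V :&: lker (linfun g) = 0)%VS.
  apply/eqP; rewrite -subv0; apply/subvP => v; rewrite memv_cap memv_ker lfunE /=.
  case/andP=> vV /eqP fv0; rewrite memv0; apply/eqP/ffunP => w; rewrite ffunE.
  have := fV v v vV fv0; under eq_bigr do rewrite -normCK.
  move/psumr_eq0P => /(_ (fun w _ => exprn_ge0 _ (normr_ge0 _)) w isT) /eqP.
  by rewrite expf_eq0 /= normr_eq0 => /eqP.
have gV : (linfun g @: V = fullv)%VS.
  by apply/eqP; rewrite eqEdim subvf limg_dim_eq //= dimvf /dim /= mul1n.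
pose t : E := [ffun w => T w].
have : linfun g t \in (linfun g @: V)%VS by rewrite gV memvf.
case/memv_imgP => z zV; rewrite !lfunE /= => fzt.
exists (fun w => z w); first exact/VP.
move=> Z' PZ'; pose z' : E := [ffun w => Z' w].
have z'V : z' \in V by apply/VP; move: PZ'; congr P; apply/funext => w; rewrite ffunE.
have ftz : f (t - z) = 0 by rewrite -[f _]/(g (t - z)) linearB /= fzt subrr.
rewrite -[RHS](fV _ _ z'V ftz); apply: eq_bigr => w _.
by rewrite !ffunE.
Qed.

(** * The first fundamental theorem for the symplectic Lie algebra *)

Section Tensors.

Context (C : numClosedFieldType) (n : nat) (J : 'M[C]_n) (I : finType).
Local Notation word := {ffun I -> 'I_n}.
Implicit Types (w : word) (T : word -> C) (A : {set I}) (i j l : I).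

Definition put w i a : word := [ffun k => if k == i then a else w k].
Definition swap w i j : word := [ffun k => w (tperm i j k)].

Lemma put_eq w i a : put w i a i = a. Proof. by rewrite ffunE eqxx. Qed.
Lemma put_neq w i j a : j != i -> put w i a j = w j.
Proof. by rewrite ffunE => /negPf->. Qed.
Lemma put_put w i a b : put (put w i a) i b = put w i b.
Proof. by apply/ffunP => k; rewrite !ffunE; case: eqP. Qed.
Lemma put_id w i : put w i (w i) = w.
Proof. by apply/ffunP => k; rewrite !ffunE; case: eqP => [->|]. Qed.
Lemma putC w i j a b : i != j -> put (put w i a) j b = put (put w j b) i a.
Proof.
move=> ij; apply/ffunP => k; rewrite !ffunE; case: (eqVneq k j) => // ->.
by rewrite eq_sym (negPf ij).
Qed.
Lemma put_swap w i j : i != j -> put (put w j (w i)) i (w j) = swap w i j.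
Proof.
move=> ij; apply/ffunP => k; rewrite !ffunE; case: tpermP => [->|->|].
- by rewrite eqxx.
- by rewrite eqxx eq_sym (negPf ij).
- by move=> /eqP/negPf-> /eqP/negPf->.
Qed.

Definition depends_on A T := forall w w', (forall i, i \in A -> w i = w' i) -> T w = T w'.

(** The matrices S J with S symmetric form the Lie algebra sp of J; the sum is
    the action of S J as a derivation on the slots in A. *)
Definition sp_killed A T := forall S : 'M[C]_n, S^T = S ->
  forall w, \sum_(i in A) \sum_c (S *m J) (w i) c * T (put w i c) = 0.

(** The elementary matrix E_ab acting as a derivation on the slots in A. *)
Definition gl_act A (a b : 'I_n) T w : C := \sum_(i in A) (w i == a)%:R * T (put w i b).

Definition contract i j T w : C := \sum_a \sum_c J a c * T (put (put w j a) i c).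

(** Up to the term #|A| T this is the Casimir operator of gl; this term is what
    the symplectic part of the computation contributes in sp_killed_casimir. *)
Definition casimir A T w : C :=
  #|A|%:R * T w + \sum_a \sum_b gl_act A b a (gl_act A a b T) w.

Lemma gl_act_adjoint A a b (Z T : word -> C) :
  \sum_w gl_act A b a Z w * (T w)^* = \sum_w Z w * (gl_act A a b T w)^*.
Proof.
rewrite (eq_bigr (fun w => \sum_(i in A) ((w i == b)%:R * Z (put w i a) * (T w)^*))); last first.
  by move=> w _; rewrite mulr_suml.
rewrite [RHS](eq_bigr (fun w => \sum_(i in A) ((w i == a)%:R * (Z w * (T (put w i b))^*)))); last first.
  move=> w _; rewrite rmorph_sum mulr_sumr; apply: eq_bigr => i _ /=.
  by rewrite rmorphM /= conjC_nat mulrCA.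
rewrite exchange_big [RHS]exchange_big; apply: eq_bigr => i _ /=.
under eq_bigr do rewrite -mulrA mulr_natl mulrb.
rewrite -big_mkcond; under [RHS]eq_bigr do rewrite mulr_natl mulrb.
rewrite -big_mkcond /= [RHS](reindex_onto (fun w => put w i a) (fun w => put w i b)).
  apply: eq_big => w; last by move=> /eqP <-; rewrite put_put put_id.
  rewrite put_eq eqxx put_put; apply/eqP/eqP => [<-|]; first by rewrite put_id.
  by move=> <-; rewrite put_eq.
by move=> w /eqP <-; rewrite put_put put_id.
Qed.

(** Pairing casimir A T with T gives #|A| |T|^2 plus the sum of the |E_ab T|^2,
    because E_ba is the adjoint of E_ab; with A nonempty this forces T = 0. *)
Lemma casimir_inj A T : A != set0 -> (forall w, casimir A T w = 0) -> forall w, T w = 0.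
Proof.
move=> A0 cT0 w0.
have mass : #|A|%:R * (\sum_w `|T w| ^+ 2) +
    \sum_a \sum_b \sum_w `|gl_act A a b T w| ^+ 2 = 0.
  transitivity (\sum_w casimir A T w * (T w)^*); last first.
    by apply: big1 => w _; rewrite cT0 mul0r.
  rewrite [RHS](eq_bigr (fun w => #|A|%:R * `|T w| ^+ 2 +
     \sum_a \sum_b gl_act A b a (gl_act A a b T) w * (T w)^*)); last first.
    move=> w _; rewrite /casimir mulrDl normCK -mulrA; congr (_ + _).
    by rewrite mulr_suml; apply: eq_bigr => a _; rewrite mulr_suml.
  rewrite big_split /= -mulr_sumr; congr (_ + _).
  rewrite [RHS]exchange_big; apply: eq_bigr => a _ /=.
  rewrite [RHS]exchange_big; apply: eq_bigr => b _ /=.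
  by rewrite gl_act_adjoint; apply: eq_bigr => w _; rewrite normCK.
have sq0 (Z : word -> C) : 0 <= \sum_w `|Z w| ^+ 2.
  by apply: sumr_ge0 => w _; rewrite exprn_ge0.
move/eqP: mass; rewrite paddr_eq0; first last.
- by do 2!(apply: sumr_ge0 => ? _).
- by rewrite mulr_ge0.
rewrite mulf_eq0 pnatr_eq0 cards_eq0 (negPf A0) /= => /andP[/eqP + _].
move=> /psumr_eq0P => /(_ (fun w _ => exprn_ge0 _ (normr_ge0 _)) w0 isT) /eqP.
by rewrite expf_eq0 /= normr_eq0 => /eqP.
Qed.

(** Acting by E_ba and E_ab on two distinct slots and summing over a and b
    exchanges the contents of the slots.  So casimir preserves every linear
    family of tensors that is stable under permutations of the slots. *)
Lemma casimir_swap A T w : casimir A T w = (#|A| + n * #|A|)%:R * T w +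
  \sum_(j in A) \sum_(i in A | i != j) T (swap w i j).
Proof.
rewrite /casimir natrD mulrDl -addrA; congr (_ + _).
have -> : \sum_a \sum_b gl_act A b a (gl_act A a b T) w =
   \sum_(j in A) \sum_(i in A) \sum_a (put w j a i == a)%:R * T (put (put w j a) i (w j)).
  rewrite [RHS](eq_bigr (fun j => \sum_a \sum_(i in A)
      (put w j a i == a)%:R * T (put (put w j a) i (w j)))); last first.
    by move=> j _; rewrite exchange_big.
  rewrite [RHS]exchange_big; apply: eq_bigr => a _ /=.
  rewrite exchange_big; apply: eq_bigr => j _ /=.
  rewrite (bigD1 (w j)) //= eqxx mul1r big1 ?addr0 // => b /negPf.
  by rewrite eq_sym => ->; rewrite mul0r.
under eq_bigr => j Aj.
  rewrite (bigD1 j) //=.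
  under eq_bigr do rewrite put_eq eqxx mul1r put_put put_id.
  rewrite sumr_const card_ord.
  under [X in _ + X]eq_bigr => i /andP[Ai ij].
    under eq_bigr do rewrite put_neq // mulr_natl mulrb.
    rewrite -big_mkcond (big_pred1 (w i)) /=; last by move=> a; rewrite eq_sym.
    rewrite put_swap //. over.
  over.
rewrite big_split /= sumr_const; congr (_ + _).
by rewrite -mulrnA mulr_natl.
Qed.

Lemma depends_contract A i j T : depends_on A T ->
  depends_on (A :\ i :\ j) (contract i j T).
Proof.
move=> dT w w' ww'; apply: eq_bigr => a _; apply: eq_bigr => c _; congr (_ * _).
apply: dT => k Ak; rewrite !ffunE; case: eqVneq => // ki; case: eqVneq => // kj.
by apply: ww'; rewrite !inE ki kj.
Qed.

Hypothesis (Jalt : J^T = - J) (JJ : J *m J = - 1%:M).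

(** J is invariant under sp, so contracting with J is equivariant: what N = S J
    contributes in the slots i and j is the pairing with J N + N^T J = 0. *)
Lemma sp_killed_contract A i j T : i \in A -> j \in A -> i != j ->
  sp_killed A T -> sp_killed (A :\ i :\ j) (contract i j T).
Proof.
move=> Ai Aj ij kT S ST w; set N := S *m J.
have Nsp : J *m N + N^T *m J = 0.
  by rewrite trmx_mul ST Jalt -!mulmxA mulNmx subrr.
have -> : \sum_(l in A :\ i :\ j) \sum_d N (w l) d * contract i j T (put w l d) =
  \sum_a \sum_c J a c * \sum_(l in A :\ i :\ j) \sum_d
     N (put (put w j a) i c l) d * T (put (put (put w j a) i c) l d).
  under [RHS]eq_bigr do under eq_bigr do rewrite mulr_sumr.
  under [RHS]eq_bigr do rewrite exchange_big.
  rewrite [RHS]exchange_big /=; apply: eq_bigr => l; rewrite !inE => /and3P[lj li Al].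
  under [LHS]eq_bigr do rewrite mulr_sumr.
  rewrite exchange_big; apply: eq_bigr => a _ /=.
  under [LHS]eq_bigr do rewrite mulr_sumr.
  rewrite exchange_big; apply: eq_bigr => c _ /=.
  rewrite mulr_sumr; apply: eq_bigr => d _.
  rewrite mulrCA !(put_neq _ _ li, put_neq _ _ lj).
  by rewrite (putC _ _ _ lj) (putC _ _ _ li).
transitivity (- (\sum_a \sum_c (J *m N + N^T *m J) a c * T (put (put w j a) i c))); last first.
  by rewrite big1 ?oppr0 // => a _; rewrite big1 // => c _; rewrite Nsp mxE mul0r.
apply/eqP; rewrite -addr_eq0; apply/eqP.
have -> : \sum_a \sum_c (J *m N + N^T *m J) a c * T (put (put w j a) i c) =
  \sum_a \sum_c J a c * (\sum_d N (put (put w j a) i c i) d * T (put (put (put w j a) i c) i d) +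
     \sum_d N (put (put w j a) i c j) d * T (put (put (put w j a) i c) j d)).
  have -> : \sum_a \sum_c (J *m N + N^T *m J) a c * T (put (put w j a) i c) =
    \sum_a \sum_c (J *m N) a c * T (put (put w j a) i c) +
    \sum_a \sum_c (N^T *m J) a c * T (put (put w j a) i c).
    rewrite -big_split; apply: eq_bigr => a _; rewrite -big_split.
    by apply: eq_bigr => c _; rewrite /= -mulrDl mxE.
  have -> (F G : 'I_n -> 'I_n -> C) : \sum_a \sum_c J a c * (F a c + G a c) =
     \sum_a \sum_c J a c * F a c + \sum_a \sum_c J a c * G a c.
    rewrite -big_split; apply: eq_bigr => a _; rewrite -big_split.
    by apply: eq_bigr => c _; rewrite /= -mulrDr.
  congr (_ + _).
    apply: eq_bigr => a _.
    under [RHS]eq_bigr do rewrite put_eq mulr_sumr.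
    rewrite [RHS]exchange_big; apply: eq_bigr => d _.
    rewrite [in LHS]mxE mulr_suml; apply: eq_bigr => c _.
    by rewrite put_put mulrA.
  rewrite exchange_big [RHS]exchange_big; apply: eq_bigr => c _.
  under [RHS]eq_bigr do rewrite mulr_sumr.
  rewrite [RHS]exchange_big; apply: eq_bigr => d _.
  rewrite [in LHS]mxE mulr_suml; apply: eq_bigr => a _.
  have ji : j != i by rewrite eq_sym.
  by rewrite mxE put_neq // put_eq (putC _ _ _ ij) put_put mulrA [_ * J a c]mulrC.
rewrite -big_split big1 //= => a _; rewrite -big_split big1 //= => c _.
rewrite -mulrDr; apply/eqP; rewrite mulf_eq0; apply/orP; right.
have := kT S ST (put (put w j a) i c); rewrite (bigD1 i) //= (bigD1 j) /=; last first.
  by rewrite Aj eq_sym.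
rewrite -/N => sum0; apply/eqP; rewrite -[RHS]sum0 [LHS]addrC [RHS]addrA; congr (_ + _).
by apply: eq_bigl => l; rewrite !inE; case: (l \in A) (l == i) (l == j) => [] [] [].
Qed.

(** The matrix E_ab + J E_ba J lies in sp.  Applying E_ba after it and summing
    over a and b gives 0; in the second summand equal slots contribute T, as
    J^T J = 1, and distinct slots i, j contribute J_ij times a contraction. *)
Lemma sp_killed_casimir A T w : sp_killed A T ->
  casimir A T w =
  \sum_(j in A) \sum_(i in A | i != j) - (J (w i) (w j) * contract i j T w).
Proof.
move=> kT; have Xab a b w' : gl_act A a b T w' +
    \sum_(i in A) \sum_c J (w' i) b * J a c * T (put w' i c) = 0.
  (* S is chosen so that S J = E_ab + J E_ba J. *)
  pose S := J *m delta_mx b a - delta_mx a b *m J.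
  have ST : S^T = S.
    rewrite /S linearB /= !trmx_mul !trmx_delta Jalt mulmxN mulNmx opprK.
    by rewrite addrC.
  rewrite -[RHS](kT S ST w') -big_split; apply: eq_bigr => i _ /=.
  have SJ : S *m J = J *m delta_mx b a *m J + delta_mx a b.
    by rewrite mulmxBl -[X in _ - X]mulmxA JJ mulmxN mulmx1 opprK.
  have -> : (w' i == a)%:R * T (put w' i b) =
      \sum_c (delta_mx a b) (w' i) c * T (put w' i c).
    rewrite (bigD1 b) //= big1 ?addr0 => [|c /negPf cb].
      by rewrite mxE eqxx andbT.
    by rewrite mxE cb andbF mul0r.
  rewrite -big_split; apply: eq_bigr => c _ /=; rewrite -mulrDl SJ [in RHS]mxE [in LHS]addrC.
  congr ((_ + _) * _); rewrite -[in RHS](mul_delta_mx (0 : 'I_1)) mulmxA -mulmxA.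
  rewrite mxE big_ord1 -rowE -colE !mxE.
  by [].
have key : \sum_a \sum_b gl_act A b a (gl_act A a b T) w =
   - \sum_(j in A) \sum_(i in A) \sum_a \sum_c
       J (put w j a i) (w j) * J a c * T (put (put w j a) i c).
  rewrite [in RHS](eq_bigr (fun j => \sum_a \sum_(i in A) \sum_c
       J (put w j a i) (w j) * J a c * T (put (put w j a) i c))); last first.
    by move=> j _; rewrite exchange_big.
  rewrite [in RHS]exchange_big -sumrN /=; apply: eq_bigr => a _.
  transitivity (\sum_(j in A) \sum_b (w j == b)%:R * gl_act A a b T (put w j a)).
    by rewrite exchange_big.
  rewrite -sumrN; apply: eq_bigr => j _.
  rewrite (bigD1 (w j)) //= eqxx mul1r big1 ?addr0 => [|b]; last first.
    by rewrite eq_sym => /negPf->; rewrite mul0r.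
  by apply/eqP; rewrite -addr_eq0 Xab.
rewrite /casimir key -sumrN mulr_natl -sumr_const -big_split /=.
apply: eq_bigr => j Aj; rewrite (bigD1 j) //= opprD addrA.
have -> : \sum_a \sum_c J (put w j a j) (w j) * J a c * T (put (put w j a) j c) = T w.
  rewrite exchange_big /= (bigD1 (w j)) //= [X in _ + X]big1 ?addr0 => [|c cj].
    under eq_bigr do rewrite put_eq put_put put_id.
    rewrite -mulr_suml; have := congr1 (fun M : 'M_n => M (w j) (w j)) JJ.
    rewrite !mxE eqxx => JJjj; rewrite -[RHS]mul1r; congr (_ * _).
    rewrite -[RHS]opprK -JJjj -sumrN; apply: eq_bigr => a _.
    have := congr1 (fun M : 'M_n => M a (w j)) Jalt.
    by rewrite !mxE => ->; rewrite mulNr opprK.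
  under eq_bigr do rewrite put_eq put_put.
  rewrite -mulr_suml (_ : \sum_a _ = 0) ?mul0r //.
  have := congr1 (fun M : 'M_n => M (w j) c) JJ.
  rewrite !mxE eq_sym (negPf cj) oppr0 => JJjc.
  transitivity (- \sum_d J (w j) d * J d c); last by rewrite JJjc oppr0.
  rewrite -sumrN; apply: eq_bigr => a _.
  have := congr1 (fun M : 'M_n => M a (w j)) Jalt.
  by rewrite !mxE => ->; rewrite mulNr opprK.
rewrite subrr add0r -sumrN; apply: eq_bigr => i /andP[Ai ij]; congr (- _).
rewrite /contract mulr_sumr; apply: eq_bigr => a _; rewrite mulr_sumr.
by apply: eq_bigr => c _; rewrite put_neq // mulrA.
Qed.

(** First fundamental theorem, as an induction principle.  The least family M
    with these closure properties consists of the combinations of products of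
    J_ij over perfect matchings of A.  By induction on A the right-hand side of
    sp_killed_casimir lies in M A; casimir preserves M A and is injective, hence
    T lies in M A too. *)
Theorem fft_sp (M : {set I} -> (word -> C) -> Prop) :
    (forall A, M A (fun=> 0)) ->
    (forall A c T T', M A T -> M A T' -> M A (fun w => c * T w + T' w)) ->
    (forall A i j T, i \in A -> j \in A -> i != j -> M A T ->
       M A (fun w => T (swap w i j))) ->
    M set0 (fun=> 1) ->
    (forall A i j T, i \in A -> j \in A -> i != j ->
       depends_on (A :\ i :\ j) T -> M (A :\ i :\ j) T ->
       M A (fun w => J (w i) (w j) * T w)) ->
  forall A T, depends_on A T -> sp_killed A T -> M A T.
Proof.
move=> M0 ML Mswap M1 MJ A; have [m] := ubnP #|A|; elim: m A => // m IHm A leAm T dT kT.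
have Msum A' (K : Type) (r : seq K) (Q : pred K) (F : K -> word -> C) :
    (forall k, Q k -> M A' (F k)) -> M A' (fun w => \sum_(k <- r | Q k) F k w).
  move=> MF; elim: r => [|k r IHr].
    by rewrite (_ : (fun w => _) = fun=> 0) //; apply/funext => w; rewrite big_nil.
  case Qk: (Q k); last first.
    rewrite (_ : (fun w => _) = (fun w => \sum_(k <- r | Q k) F k w)) //.
    by apply/funext => w; rewrite big_cons Qk.
  rewrite (_ : (fun w => _) = (fun w => 1 * F k w + \sum_(k <- r | Q k) F k w)).
    by apply: ML => //; apply: MF.
  by apply/funext => w; rewrite big_cons Qk mul1r.
have MZ A' c T' : M A' T' -> M A' (fun w => c * T' w).
  move=> MT; rewrite (_ : (fun w => _) = (fun w => c * T' w + 0)).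
    by apply: ML.
  by apply/funext => w; rewrite addr0.
have [A0|An0] := eqVneq A set0.
  case: (pickP (fun _ : word => true)) => [w0 _|w0]; last first.
    rewrite (_ : T = fun=> 0) //; apply/funext => w.
    by have := w0 w.
  rewrite (_ : T = fun w => T w0 * 1); first by rewrite A0; apply: MZ.
  by apply/funext => w; rewrite mulr1; apply: dT => i; rewrite A0 inE.
apply: (injective_reflects_stable (L := casimir A)) => //.
- exact: ML.
- move=> c T1 T2 w; rewrite !casimir_swap [in RHS]mulrDr addrACA; congr (_ + _).
    by rewrite mulrDr mulrCA.
  rewrite mulr_sumr -big_split; apply: eq_bigr => j _ /=.
  by rewrite mulr_sumr -big_split.
- by move=> T'; apply: casimir_inj.
- move=> T' MT'; rewrite (_ : casimir A T' = fun w => (#|A| + n * #|A|)%:R * T' w +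
     \sum_(j in A) \sum_(i in A | i != j) T' (swap w i j)); last first.
    by apply/funext => w; rewrite casimir_swap.
  apply: ML => //; apply: (Msum) => j Aj; apply: Msum => i /andP[Ai ij].
  exact: Mswap.
rewrite (_ : casimir A T = fun w => \sum_(j in A) \sum_(i in A | i != j)
    - 1 * (J (w i) (w j) * contract i j T w)); last first.
  apply/funext => w; rewrite sp_killed_casimir //; apply: eq_bigr => j _.
  by apply: eq_bigr => i _; rewrite mulN1r.
apply: (Msum) => j Aj; apply: Msum => i /andP[Ai ij].
apply: (MZ _ _ (fun w => J (w i) (w j) * contract i j T w)); apply: MJ => //.
  exact: depends_contract.
apply: IHm.
- rewrite ltnS in leAm; apply: leq_trans leAm; rewrite (cardsD1 i A) Ai ltnS.
  by apply: subset_leq_card; apply: subD1set.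
- exact: depends_contract.
- exact: sp_killed_contract.
Qed.

End Tensors.

(** * Matrices with vanishing power traces *)

Lemma deriv_prod (R : comNzRingType) (I : finType) (p : I -> {poly R}) :
  (\prod_i p i)^`() = \sum_i (p i)^`() * \prod_(k | k != i) p k.
Proof.
have main (r : seq I) : uniq r ->
  (\prod_(i <- r) p i)^`() = \sum_(i <- r) (p i)^`() * \prod_(k <- r | k != i) p k.
  elim: r => [|i r IHr] /=; first by rewrite !big_nil derivC.
  case/andP=> ir ur; rewrite !big_cons derivM eqxx /= IHr //; congr (_ + _).
    congr (_ * _); rewrite [RHS]big_seq_cond [LHS]big_seq; apply: eq_bigl => k.
    by case: eqVneq ir => [->|]; rewrite ?andbT ?andbF // => /negPf.
  rewrite mulr_sumr [LHS]big_seq [RHS]big_seq; apply: eq_bigr => j jr.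
  by rewrite big_cons (memPnC ir _ jr) mulrCA.
by rewrite [LHS]main // /index_enum -enumT enum_uniq.
Qed.

(** Jacobi's formula: the factor of the i-th row that is differentiated is
    nonzero, and then 1, only for permutations fixing i, and these permutations
    make up the (i, i) cofactor. *)
Lemma deriv_char_poly (R : comNzRingType) n (A : 'M[R]_n) :
  (char_poly A)^`() = \tr (\adj (char_poly_mx A)).
Proof.
set M := char_poly_mx A.
have dM i j : (M i j)^`() = (i == j)%:R.
  by rewrite !mxE derivB derivC subr0 derivMn derivX.
rewrite /char_poly -/M /determinant /mxtrace raddf_sum /=.
transitivity (\sum_(s : 'S_n) \sum_(i | s i == i) (-1) ^+ s * \prod_(k | i != k) M k (s k)).
  apply: eq_bigr => s _.
  have -> : ((-1) ^+ s * \prod_i M i (s i))^`() = (-1) ^+ s * (\prod_i M i (s i))^`().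
    by rewrite !mulr_sign; case: (odd_perm s); rewrite ?derivN.
  rewrite deriv_prod [RHS]big_mkcond mulr_sumr; apply: eq_bigr => i _.
  rewrite dM eq_sym; case: eqP => _; last by rewrite mul0r mulr0.
  by rewrite mul1r; congr (_ * _); apply: eq_bigl => k; rewrite eq_sym.
rewrite (exchange_big_dep predT) //=; apply: eq_bigr => i _.
by rewrite mxE expand_cofactor.
Qed.

(** Let M = t - A and let chi be the characteristic polynomial.  Since
    A^(N+1) = 0, M * sum_(j <= N) t^(N-j) A^j = t^(N+1).  Multiplying by the
    adjugate of M and taking traces gives t^(N+1) chi' = (n+1) t^N chi, as only
    j = 0 has a nonzero trace.  Hence chi = t^(n+1), and Cayley-Hamilton
    concludes. *)
Lemma nilpotent_of_trace (R : comNzRingType) n (A : 'M[R]_n.+1) N :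
    (forall m (x : R), (0 < m)%N -> x *+ m = 0 -> x = 0) ->
    A ^+ N = 0 -> (forall j, (0 < j)%N -> \tr (A ^+ j) = 0) ->
  A ^+ n.+1 = 0.
Proof.
move=> tfree AN0 trA.
have {}AN0 : A ^+ N.+1 = 0 by rewrite exprS AN0 mulr0.
set M := char_poly_mx A; set Ap := map_mx polyC A.
have ApX j : Ap ^+ j = map_mx polyC (A ^+ j) by rewrite -rmorphXn.
have geom : M *m \sum_(j < N.+1) ('X^(N - j))%:M * Ap ^+ j = ('X^(N.+1))%:M.
  have -> : M = 'X%:M - Ap by [].
  have comX : GRing.comm ('X%:M : 'M[{poly R}]_n.+1) Ap by exact/esym/scalar_mxC.
  transitivity (('X%:M : 'M_n.+1) ^+ N.+1 - Ap ^+ N.+1).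
    rewrite (subrXX_comm _ comX); congr (_ *m _); apply: eq_bigr => j _.
    by rewrite rmorphXn.
  by rewrite ApX AN0 map_mx0 subr0 -rmorphXn.
have key : 'X^(N.+1) * (char_poly A)^`() = (char_poly A *+ n.+1) * 'X^N.
  rewrite deriv_char_poly -mxtraceZ -/M.
  have -> : 'X^(N.+1) *: \adj M = \adj M *m ('X^(N.+1))%:M.
    by rewrite scalar_mxC mul_scalar_mx.
  rewrite -geom mulmxA mul_adj_mx mul_scalar_mx mxtraceZ mulrnAl -mulrnAr.
  congr (_ * _); rewrite raddf_sum (bigD1 ord0) //= subn0 expr0 mulr1.
  rewrite mxtrace_scalar big1 ?addr0 // => j j0.
  rewrite [_ * _]mul_scalar_mx mxtraceZ ApX trace_map_mx trA ?mulr0 //.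
  by rewrite lt0n.
have cp0 i : (i < n.+1)%N -> (char_poly A)`_i = 0.
  move=> ltin; apply: (tfree (n.+1 - i)%N); first by rewrite subn_gt0.
  have := congr1 (fun p : {poly R} => p`_(N + i)) key.
  rewrite exprSr -mulrA coefXnM coefMXn ltnNge leq_addr /= addKn.
  rewrite coefMn mulrnBr ?(ltnW ltin) // => <-; rewrite coefXM coef_deriv.
  by case: i {ltin} => [|i] /=; rewrite ?mulr0n ?subrr.
transitivity (horner_mx A 'X^(n.+1)); first by rewrite rmorphXn /= horner_mx_X.
rewrite -[RHS](Cayley_Hamilton A).
congr (horner_mx A _); apply/polyP => i; rewrite coefXn.
case: (ltngtP i n.+1) => [/cp0->//|lt|->].
  by rewrite nth_default // size_char_poly.
by have /monicP := char_poly_monic A; rewrite /lead_coef size_char_poly.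
Qed.

(** * Lifting group invariants to tensors *)

Section TensorAction.

Context (C : numClosedFieldType) (n : nat) (I : finType).
Local Notation word := {ffun I -> 'I_n}.
Implicit Types (T : word -> C) (g : 'M[C]_n).

Definition tens_act g T (w : word) : C :=
  \sum_(u : word) (\prod_i g (w i) (u i)) * T u.

Lemma tens_act_adjoint g (T Z : word -> C) :
  \sum_w tens_act g T w * (Z w)^* =
  \sum_w T w * (tens_act (map_mx Num.conj g^T) Z w)^*.
Proof.
transitivity (\sum_(w : word) \sum_(u : word) (\prod_i g (w i) (u i)) * T u * (Z w)^*).
  by apply: eq_bigr => w _; rewrite mulr_suml.
rewrite exchange_big; apply: eq_bigr => u _ /=.
rewrite rmorph_sum mulr_sumr; apply: eq_bigr => w _ /=.
rewrite rmorphM rmorph_prod /= mulrA; congr (_ * _); rewrite mulrC; congr (_ * _).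
by apply: eq_bigr => i _; rewrite !mxE conjCK.
Qed.

(** The kernel of p is stable under all matrices, in particular under conjugate
    transposes; so its orthogonal complement is stable under all matrices, and
    the lift of p T0 in this complement is unique, hence fixed by every g that
    fixes p T0. *)
Lemma invariant_lift (W : lmodType C) (p : (word -> C) -> W) (G : 'M[C]_n -> W -> W) :
    (forall c T T', p (fun w => c * T w + T' w) = c *: p T + p T') ->
    (forall g, G g 0 = 0) -> (forall g T, p (tens_act g T) = G g (p T)) ->
  forall T0, exists2 T, p T = p T0 &
    forall g, G g (p T0) = p T0 -> forall w, tens_act g T w = T w.
Proof.
move=> pL G0 pG T0.
have p0 : p (fun=> 0) = 0.
  have := pL (-1) (fun=> 0) (fun=> 0); rewrite scaleN1r addNr => <-; congr p.
  by apply/funext => w; rewrite mulr0 addr0.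
have [|c T T' pT pT'|Z pZ orthZ] := @orthogonal_projection C _ (fun T => p T = 0) _ _ T0.
- exact: p0.
- by rewrite pL pT pT' scaler0 addr0.
pose T w := T0 w - Z w.
have pT : p T = p T0.
  transitivity (p (fun w => -1 * Z w + T0 w)).
    by congr p; apply/funext => w; rewrite mulN1r addrC.
  by rewrite pL pZ scaler0 add0r.
exists T => // g gT w.
pose D w := -1 * T w + tens_act g T w.
have pD : p D = 0 by rewrite pL pG pT gT scaleN1r addNr.
have DD : \sum_u D u * (D u)^* = 0.
  transitivity (- (\sum_u T u * (D u)^*) + \sum_u tens_act g T u * (D u)^*).
    rewrite -sumrN -big_split; apply: eq_bigr => u _.
    by rewrite {1}/D mulrDl mulN1r mulNr.
  rewrite orthZ // tens_act_adjoint orthZ ?oppr0 ?addr0 //.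
  by rewrite pG pD G0.
move: DD; under eq_bigr do rewrite -normCK.
move/psumr_eq0P => /(_ (fun w _ => exprn_ge0 _ (normr_ge0 _)) w isT) /eqP.
rewrite expf_eq0 /= normr_eq0 /D mulN1r addrC subr_eq0 => /eqP //.
Qed.

Lemma poly_vanishing (p : {poly C}) : (forall t, p.[t] = 0) -> p = 0.
Proof.
move=> p0; pose rs : seq C := [seq j%:R | j <- iota 0 (size p)].
apply: (@roots_geq_poly_eq0 _ p rs).
- by apply/allP => t _; apply/rootP.
- by rewrite map_inj_uniq ?iota_uniq // => i j /eqP; rewrite eqr_nat => /eqP.
- by rewrite size_map size_iota.
Qed.

(** The action of 1 + t N is a polynomial in t, which is constant at T; its
    coefficient of t is the derivation action of N. *)
Lemma tens_act_derivative (N : 'M[C]_n) T :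
    (forall t w, tens_act (1%:M + t *: N) T w = T w) ->
  forall w : word, \sum_i \sum_c N (w i) c * T (put w i c) = 0.
Proof.
move=> NT w.
pose f (u : word) i : {poly C} := (w i == u i)%:R%:P + N (w i) (u i) *: 'X.
pose p : {poly C} := \sum_u (T u)%:P * \prod_i f u i - (T w)%:P.
have fE u i t : (f u i).[t] = (1%:M + t *: N) (w i) (u i).
  by rewrite /f !hornerE !mxE [_ * t]mulrC.
have p0 : p = 0.
  apply: poly_vanishing => t; rewrite hornerD hornerN hornerC horner_sum.
  rewrite -[in X in _ - X](NT t w) /tens_act -sumrB big1 // => u _.
  rewrite hornerM hornerC horner_prod mulrC.
  by under eq_bigr do rewrite fE; rewrite subrr.
have D0 := congr1 (fun q : {poly C} => q^`().[0]) p0.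
rewrite derivC horner0 in D0; rewrite -[RHS]D0 /p derivB derivC subr0 raddf_sum horner_sum /=.
transitivity (\sum_(u : word) \sum_i T u * (N (w i) (u i) * (\prod_(k | k != i) (w k == u k)%:R))); last first.
  apply: eq_bigr => u _; rewrite derivM derivC mul0r add0r hornerM hornerC.
  rewrite deriv_prod horner_sum mulr_sumr; apply: eq_bigr => i _.
  rewrite hornerM horner_prod /f derivD derivC add0r derivZ derivX hornerZ hornerC mulr1.
  congr (_ * (_ * _)); apply: eq_bigr => k _.
  by rewrite hornerD hornerC hornerZ hornerX mulr0 addr0.
rewrite [RHS]exchange_big; apply: eq_bigr => i _; apply: esym => /=.
rewrite (bigID (fun u : word => u == put w i (u i))) /= [X in _ + X]big1 ?addr0; last first.
  move=> u uw; suff [k ki wk] : exists2 k, k != i & w k != u k.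
    by rewrite (bigD1 k) //= (negPf wk) mul0r !mulr0.
  apply/exists_inP; apply: contraNT uw; rewrite negb_exists_in => /forall_inP wu.
  apply/eqP/ffunP => k; rewrite ffunE; case: eqVneq => [->//|ki].
  by have := wu k ki; rewrite negbK => /eqP.
rewrite (reindex_onto (fun c => put w i c) (fun u : word => u i)) => [|u /eqP <- //] /=.
apply: eq_big => [c|c _]; first by rewrite put_eq !eqxx.
rewrite put_eq big1 ?mulr1 1?mulrC // => k ki.
by rewrite put_neq // eqxx.
Qed.

End TensorAction.

Section Transvections.

Context (C : numClosedFieldType) (n : nat) (J : 'M[C]_n).

Definition transvection (t : C) (v : 'rV[C]_n) : 'M[C]_n := 1%:M + t *: (v^T *m v *m J).

(** A transvection is 1 + t N with N = v^T v J, and by polarization the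
    matrices v^T v span the symmetric matrices. *)
Lemma transvections_sp_killed (I : finType) (T : {ffun I -> 'I_n} -> C) :
  (forall t v w, tens_act (transvection t v) T w = T w) -> sp_killed J setT T.
Proof.
move=> inv S ST w; pose kill (M : 'M[C]_n) := \sum_i \sum_c (M *m J) (w i) c * T (put w i c).
have killL c M M' : kill (c *: M + M') = c * kill M + kill M'.
  rewrite /kill mulr_sumr -big_split; apply: eq_bigr => i _ /=.
  rewrite mulr_sumr -big_split; apply: eq_bigr => b _ /=.
  by rewrite mulmxDl -scalemxAl !mxE mulrDl -mulrA.
have kill0 : kill 0 = 0.
  by have := killL (-1) 0 0; rewrite scaler0 addr0 mulN1r addNr.
have killv (v : 'rV_n) : kill (v^T *m v) = 0.
  by apply: (@tens_act_derivative _ _ _ (v^T *m v *m J)) => t u; apply: inv.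
pose e (a : 'I_n) : 'rV[C]_n := delta_mx 0 a.
have killab a b : kill (delta_mx a b + delta_mx b a) = 0.
  have -> : delta_mx a b + delta_mx b a = (-1) *: ((e a)^T *m e a) +
      ((-1) *: ((e b)^T *m e b) + (e a + e b)^T *m (e a + e b)).
    have -> : (e a + e b)^T = (e a)^T + (e b)^T by rewrite linearD.
    rewrite mulmxDl !mulmxDr !trmx_delta !mul_delta_mx.
    by apply/matrixP => i j; rewrite !mxE; ring.
  by rewrite !killL !killv !mulr0 !addr0.
have kill_sum (K : Type) (r : seq K) (c : K -> C) (F : K -> 'M[C]_n) :
    (forall k, kill (F k) = 0) -> kill (\sum_(k <- r) c k *: F k) = 0.
  move=> F0; elim: r => [|k r IHr]; first by rewrite big_nil.
  by rewrite big_cons killL F0 IHr mulr0 addr0.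
have S2 : S + S = \sum_p S p.1 p.2 *: (delta_mx p.1 p.2 + delta_mx p.2 p.1).
  rewrite {1 2}[S]matrix_sum_delta !pair_bigA /= -{2}ST.
  have swapK : cancel (fun p : 'I_n * 'I_n => (p.2, p.1)) (fun p => (p.2, p.1)) by case.
  rewrite [X in _ + X](reindex_inj (can_inj swapK)) /=.
  by rewrite -big_split; apply: eq_bigr => p _ /=; rewrite mxE scalerDr.
have : kill (1 *: S + S) = 0 by rewrite scale1r S2 kill_sum.
rewrite killL mul1r -mulr2n => /eqP; rewrite mulrn_eq0 /= => /eqP S0.
by rewrite -[RHS]S0; apply: eq_bigl => i; rewrite inE.
Qed.

Hypothesis Jalt : J^T = - J.

Lemma alt_form (v : 'rV[C]_n) : v *m J *m v^T = 0.
Proof.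
have sk : (v *m J *m v^T)^T = - (v *m J *m v^T).
  by rewrite !trmx_mul trmxK Jalt mulNmx mulmxN mulmxA.
apply/matrixP => i j; rewrite !ord1 [RHS]mxE.
have := congr1 (fun M : 'M_1 => M 0 0) sk; rewrite mxE [RHS]mxE => /eqP.
by rewrite -addr_eq0 -mulr2n mulrn_eq0 /= => /eqP.
Qed.

Lemma transvectionD s t v : transvection s v *m transvection t v = transvection (s + t) v.
Proof.
rewrite /transvection mulmxDl mul1mx mulmxDr mulmx1 -scalemxAl -scalemxAr.
have -> : v^T *m v *m J *m (v^T *m v *m J) = v^T *m (v *m J *m v^T) *m v *m J.
  by rewrite !mulmxA.
rewrite alt_form mulmx0 !mul0mx !scaler0 addr0 scalerDl.
by rewrite [LHS]addrC addrCA addrC -addrA addrC -!addrA; congr (_ + _); rewrite addrC.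
Qed.

Lemma transvection0 v : transvection 0 v = 1%:M.
Proof. by rewrite /transvection scale0r addr0. Qed.

Lemma transvection_unit t v : transvection t v \in unitmx.
Proof.
have : transvection t v *m transvection (- t) v = 1%:M.
  by rewrite transvectionD subrr transvection0.
by case/mulmx1_unit.
Qed.

Lemma transvection_sp t v : (transvection t v)^T *m J *m transvection t v = J.
Proof.
have -> : (transvection t v)^T *m J = J *m transvection (- t) v.
  rewrite /transvection linearD linearZ /= trmx1 !trmx_mul trmxK Jalt.
  rewrite mulmxDl mul1mx mulmxDr mulmx1 -scalemxAl -scalemxAr scaleNr -scalerN.
  by rewrite !mulNmx !mulmxA.
by rewrite -mulmxA transvectionD addNr transvection0 mulmx1.
Qed.

End Transvections.

(** * Grading and functoriality of the exterior algebra *)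

Section ExteriorGrading.

Context (K : fieldType) (U : vectType K).
Local Notation W := (exterior U).
Local Notation Ix := 'I_(\dim {:U}).
Implicit Types (x y : W) (S T : {set Ix}).

Lemma ext_power_ind d (P : W -> Prop) : P 0 ->
    (forall c x y, P x -> P y -> P (c *: x + y)) ->
    (forall S, #|S| = d -> P (ext_basis S)) ->
  forall x, x \in ext_power U d -> P x.
Proof.
move=> P0 PL PB x /ext_powerP xd; rewrite (ext_decomp x).
elim/big_ind: _ => // [y z Py Pz|S _].
  by rewrite -[y]scale1r; apply: PL.
have [Sd|/xd ->] := eqVneq #|S| d; last by rewrite scale0r.
by rewrite -[_ *: _]addr0; apply: PL => //; apply: PB.
Qed.

Lemma ext_power_basis S : ext_basis S \in ext_power U #|S|.
Proof.
by apply/ext_powerP => T TS; rewrite ffunE (negPf (contraNneq _ TS)) // => ->.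
Qed.

Lemma ext_power1 : (1 : W) \in ext_power U 0.
Proof. by have := ext_power_basis set0; rewrite cards0. Qed.

Lemma ext_powerM a b x y :
  x \in ext_power U a -> y \in ext_power U b -> x * y \in ext_power U (a + b).
Proof.
move=> xa yb; move: x xa; apply: ext_power_ind => [|c x x' Px Px'|S <-].
- by rewrite mul0r mem0v.
- by rewrite mulrDl -scalerAl memvD // memvZ.
move: y yb; apply: ext_power_ind => [|c y y' Py Py'|T <-].
- by rewrite mulr0 mem0v.
- by rewrite mulrDr -scalerAr memvD // memvZ.
rewrite ext_basisM /ext_sign; case: ifP => [dST|_]; last by rewrite scale0r mem0v.
apply: memvZ; rewrite -(_ : #|S :|: T| = #|S| + #|T|)%N ?ext_power_basis //.
by rewrite cardsU (eqP (_ : S :&: T == set0)) ?cards0 ?subn0 // setI_eq0.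
Qed.

Lemma ext_sign_swap S T : ext_sign T S = (-1) ^+ (#|S| * #|T|) * ext_sign S T :> K.
Proof.
rewrite /ext_sign disjoint_sym; case: ifP => [dST|_]; last by rewrite mulr0.
set B := [set p in setX S T | (p.2 < p.1)%N].
have -> : #|[set p in setX T S | (p.2 < p.1)%N]| = #|[set p in setX S T | (p.1 < p.2)%N]|.
  have swapK : cancel (fun p : Ix * Ix => (p.2, p.1)) (fun p => (p.2, p.1)) by case.
  rewrite -(card_imset _ (can_inj swapK)); apply: eq_card => -[i j].
  apply/imsetP/idP => [[[i' j'] + [-> ->]]|]; rewrite !inE /= => ?.
    by rewrite [(_ \in S) && _]andbC.
  by exists (j, i); rewrite // !inE /= [(_ \in T) && _]andbC.
have -> : (#|S| * #|T| = #|[set p in setX S T | (p.1 < p.2)%N]| + #|B|)%N.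
  rewrite -cardsX -(cardsID [set p : Ix * Ix | (p.1 < p.2)%N] (setX S T)).
  congr (_ + _)%N; apply: eq_card => -[i j]; rewrite !inE //=.
  case: (ltngtP i j) => [ij|ji|/val_inj ij] /=; rewrite ?andbF ?andbT //.
  apply/negP => /andP[iS]; rewrite -ij => iT.
  by move/pred0P: dST => /(_ i) /=; rewrite iS iT.
by rewrite exprD -mulrA -expr2 sqrr_sign mulr1.
Qed.

Lemma ext_supercomm a b x y :
  x \in ext_power U a -> y \in ext_power U b -> x * y = (-1) ^+ (a * b) *: (y * x).
Proof.
move=> xa yb; move: x xa; apply: ext_power_ind => [|c x x' Px Px'|S <-].
- by rewrite mul0r mulr0 scaler0.
- by rewrite mulrDl mulrDr scalerDr Px' -scalerAl Px -scalerAr !scalerA mulrC.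
move: y yb; apply: ext_power_ind => [|c y y' Py Py'|T <-].
- by rewrite mul0r mulr0 scaler0.
- by rewrite mulrDl mulrDr scalerDr Py' -scalerAr Py -scalerAl !scalerA mulrC.
by rewrite !ext_basisM (ext_sign_swap S T) scalerA signrMK setUC.
Qed.

End ExteriorGrading.

Section ExteriorMaps.

Context (K : fieldType) (U : vectType K).
Implicit Types (f g : {linear U -> U}) (x : exterior U).

Lemma ext_iota_power u : ext_iota u \in ext_power U 1.
Proof. by have := ext_power_iota (fun _ : 'I_1 => u); rewrite big_ord1. Qed.

Lemma ext_prod_iota_power (J : Type) (s : seq J) (u : J -> U) :
  \prod_(i <- s) ext_iota (u i) \in ext_power U (size s).
Proof.
elim: s => [|i s IHs]; first by rewrite big_nil ext_power1.
by rewrite big_cons -[size _]add1n ext_powerM // ext_iota_power.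
Qed.

Lemma ext_map_prod f (J : Type) (s : seq J) (P : pred J) (F : J -> exterior U) :
  ext_map f (\prod_(i <- s | P i) F i) = \prod_(i <- s | P i) ext_map f (F i).
Proof. exact: (big_morph (ext_map f) (ext_mapM f) (ext_map1 f)). Qed.

Lemma ext_map_basis f S :
  ext_map f (ext_basis S) = \prod_(i <- enum S) ext_iota (f (vbasis {:U})`_i).
Proof.
by rewrite ext_basisE ext_map_prod; apply: eq_bigr => i _; rewrite ext_map_iota.
Qed.

Lemma ext_map_power f d x : x \in ext_power U d -> ext_map f x \in ext_power U d.
Proof.
move: x; apply: ext_power_ind => [|c x y Px Py|S <-].
- by rewrite linear0 mem0v.
- by rewrite linearP memvD // memvZ.
by rewrite ext_map_basis cardE ext_prod_iota_power.
Qed.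

Lemma eq_ext_map f g x : f =1 g -> ext_map f x = ext_map g x.
Proof.
move=> fg; rewrite (ext_decomp x) !linear_sum; apply: eq_bigr => S _.
rewrite !linearZ /= !ext_map_basis; congr (_ *: _).
by apply: eq_bigr => i _; rewrite fg.
Qed.

Lemma ext_map_comp f g x :
  ext_map f (ext_map g x) = ext_map (f \o g) x.
Proof.
have [y ->] : exists y : {set _} -> K, x = \sum_S y S *: ext_basis S.
  by exists x; apply: ext_decomp.
rewrite [ext_map g _]linear_sum !linear_sum; apply: eq_bigr => S _.
rewrite !linearZ /= !ext_map_basis ext_map_prod; congr (_ *: _).
by apply: eq_bigr => i _; rewrite ext_map_iota.
Qed.

Lemma ext_map_id x : ext_map (@idfun U) x = x.
Proof.
rewrite (ext_decomp x) !linear_sum; apply: eq_bigr => S _.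
rewrite !linearZ /= !ext_map_basis; congr (_ *: _).
by rewrite [RHS]ext_basisE; apply: eq_bigr.
Qed.

Definition ext_top : exterior U := ext_basis setT.

Lemma ext_top_power : ext_top \in ext_power U (\dim {:U}).
Proof. by have := @ext_power_basis K U setT; rewrite cardsT card_ord. Qed.

Lemma ext_power_top x : x \in ext_power U (\dim {:U}) -> x = x setT *: ext_top.
Proof.
move=> /ext_powerP xN; rewrite {1}(ext_decomp x) (bigD1 setT) //= big1 ?addr0 //.
move=> S ST; rewrite xN ?scale0r //; apply: contra ST => /eqP SN.
by rewrite eqEcard subsetT cardsT card_ord SN /=.
Qed.

(** The determinant of f, read on the top exterior power. *)
Definition ext_det f : K := ext_map f ext_top setT.

Lemma ext_map_top f : ext_map f ext_top = ext_det f *: ext_top.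
Proof. exact: ext_power_top (ext_map_power f ext_top_power). Qed.

Lemma ext_top_coord : ext_top setT = 1. Proof. by rewrite ffunE eqxx. Qed.

Lemma ext_det_comp f g : ext_det (f \o g) = ext_det f * ext_det g.
Proof.
rewrite {1}/ext_det -ext_map_comp ext_map_top linearZ /= ext_map_top scalerA.
by rewrite ffunE ext_top_coord [_ *: _]mulr1 mulrC.
Qed.

Lemma ext_det_id : ext_det idfun = 1.
Proof. by rewrite /ext_det ext_map_id ext_top_coord. Qed.

Lemma eq_ext_det f g : f =1 g -> ext_det f = ext_det g.
Proof. by move=> fg; rewrite /ext_det (eq_ext_map _ fg). Qed.

End ExteriorMaps.

(** * Alternating products of odd symmetric and constant skew matrices *)

Lemma sum4_rev (V : nmodType) (I : finType) (F : I -> I -> I -> I -> V) :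
  \sum_a \sum_b \sum_c \sum_d F a b c d = \sum_d \sum_c \sum_b \sum_a F a b c d.
Proof.
transitivity (\sum_b \sum_c \sum_d \sum_a F a b c d).
  rewrite exchange_big; apply: eq_bigr => b _.
  by rewrite exchange_big; apply: eq_bigr => c _; rewrite exchange_big.
transitivity (\sum_c \sum_d \sum_b \sum_a F a b c d).
  by rewrite exchange_big; apply: eq_bigr => c _; rewrite exchange_big.
by rewrite exchange_big.
Qed.

Section Arcs.

Context (K : fieldType) (U : vectType K) (n : nat).
Local Notation W := (exterior U).
Context (J : 'M[K]_n) (x : 'M[W]_n).

(** The product x J Z, with the scalar matrix J acting by *: on entries in W. *)
Definition twist (Z : 'M[W]_n) : 'M[W]_n :=
  \matrix_(a, b) \sum_c \sum_d J c d *: (x a c * Z d b).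

(** The matrix (x J)^j x. *)
Fixpoint arc_mx (j : nat) : 'M[W]_n := if j is j'.+1 then twist (arc_mx j') else x.

(** Minus the trace of (x J)^(j+1): the result of closing an arc by J. *)
Definition loop (j : nat) : W := \sum_a \sum_b J a b *: arc_mx j a b.

Hypothesis x_deg1 : forall a b, x a b \in ext_power U 1.

Lemma arc_mx_power j a b : arc_mx j a b \in ext_power U j.+1.
Proof.
elim: j a b => [|j IHj] a b //=; rewrite mxE; apply: memv_suml => c _.
by apply: memv_suml => d _; rewrite memvZ // -[j.+2]add1n ext_powerM.
Qed.

Lemma loop_power j : loop j \in ext_power U j.+1.
Proof.
by apply: memv_suml => a _; apply: memv_suml => b _; rewrite memvZ // arc_mx_power.
Qed.

Lemma arc_mx_cat i j a b :
  \sum_c \sum_d J c d *: (arc_mx i a c * arc_mx j d b) = arc_mx (i + j).+1 a b.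
Proof.
elim: i a b => [|i IHi] a b; first by rewrite [RHS]mxE.
rewrite addSn [arc_mx _.+2]/= [RHS]mxE.
under [RHS]eq_bigr do under eq_bigr do rewrite -IHi mulr_sumr scaler_sumr.
transitivity (\sum_c \sum_d \sum_p \sum_q J c d * J p q *: (x a p * arc_mx i q c * arc_mx j d b)).
  apply: eq_bigr => c _; apply: eq_bigr => d _.
  rewrite mxE mulr_suml scaler_sumr; apply: eq_bigr => p _.
  rewrite mulr_suml scaler_sumr; apply: eq_bigr => q _.
  by rewrite -scalerAl scalerA.
rewrite exchange_big /=.
transitivity (\sum_d \sum_p \sum_q \sum_c J c d * J p q *: (x a p * arc_mx i q c * arc_mx j d b)).
  apply: eq_bigr => d _; rewrite exchange_big /=; apply: eq_bigr => p _.
  by rewrite exchange_big.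
rewrite exchange_big /=; apply: eq_bigr => p _.
rewrite exchange_big /=; apply: eq_bigr => q _.
rewrite exchange_big /=; apply: eq_bigr => c _.
rewrite mulr_sumr scaler_sumr; apply: eq_bigr => d _.
by rewrite -scalerAr scalerA mulrA [J p q * _]mulrC.
Qed.

Lemma arc_mxSr j a b : arc_mx j.+1 a b = \sum_c \sum_d J c d *: (arc_mx j a c * x d b).
Proof. by rewrite (arc_mx_cat j 0) addn0. Qed.

Hypothesis (Jalt : J^T = - J) (xsym : x^T = x).

Let JN a b : J a b = - J b a.
Proof. by have := congr1 (fun M : 'M_n => M b a) Jalt; rewrite !mxE. Qed.

(** Transposition reverses a product of j+1 odd factors x and j factors J.  The
    reordering gives (-1)^(j(j+1)/2) and the skew factors give (-1)^j. *)
Lemma arc_mx_sym j a b : arc_mx j b a = (-1) ^+ 'C(j, 2) *: arc_mx j a b.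
Proof.
elim: j a b => [|j IHj] a b.
  by rewrite scale1r; have := congr1 (fun M : 'M_n => M a b) xsym; rewrite mxE.
rewrite arc_mxSr [arc_mx j.+1]/= mxE exchange_big scaler_sumr; apply: eq_bigr => c _ /=.
rewrite scaler_sumr; apply: eq_bigr => d _.
rewrite (IHj d b) -scalerAl (ext_supercomm (arc_mx_power j d b) (x_deg1 c a)).
have -> : x c a = x a c by have := congr1 (fun M : 'M_n => M a c) xsym; rewrite mxE.
rewrite !scalerA binS bin1 muln1 exprD exprS (JN d); congr (_ *: _).
by rewrite !mulNr mul1r mulrN opprK -mulrA mulrC.
Qed.

Hypothesis char0 : forall m, (0 < m)%N -> m%:R != 0 :> K.

Let eq_oppr0 (v : W) : v = - v -> v = 0.
Proof.
move/eqP; rewrite -addr_eq0 -mulr2n -scaler_nat scaler_eq0.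
by rewrite (negPf (char0 (isT : 0 < 2)%N)) => /eqP.
Qed.

(** Here the arc is symmetric, and it is paired with the skew matrix J. *)
Lemma loop_even_bin j : ~~ odd 'C(j, 2) -> loop j = 0.
Proof.
move=> bj; apply: eq_oppr0; rewrite {1}/loop exchange_big -sumrN.
apply: eq_bigr => a _; rewrite -sumrN; apply: eq_bigr => b _.
by rewrite arc_mx_sym -signr_odd (negPf bj) scale1r JN scaleNr.
Qed.

(** Rotating the cyclic word moves one x past an odd number of odd factors. *)
Lemma loop_odd j : odd j -> loop j = 0.
Proof.
case: j => // j; rewrite /= => ej; apply: eq_oppr0.
transitivity (- \sum_a \sum_b \sum_c \sum_d J a b * J c d *: (arc_mx j d b * x a c)).
  have -> : loop j.+1 = \sum_a \sum_b \sum_c \sum_d J a b * J c d *: (x a c * arc_mx j d b).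
    apply: eq_bigr => a _; apply: eq_bigr => b _.
    rewrite [arc_mx j.+1]/= mxE scaler_sumr; apply: eq_bigr => c _.
    by rewrite scaler_sumr; apply: eq_bigr => d _; rewrite scalerA.
  do 4!(rewrite -sumrN; apply: eq_bigr => ? _); rewrite -scalerN; congr (_ *: _).
  rewrite (ext_supercomm (x_deg1 _ _) (arc_mx_power j _ _)) mul1n.
  by rewrite -signr_odd /= ej scaleN1r.
congr (- _); rewrite sum4_rev; apply: eq_bigr => d _; apply: eq_bigr => c _.
rewrite [arc_mx j.+1 _ _]arc_mxSr scaler_sumr; apply: eq_bigr => b _.
rewrite scaler_sumr; apply: eq_bigr => a _; rewrite scalerA; congr (_ *: _).
by rewrite (JN d) (JN b) mulrNN mulrC.
Qed.

End Arcs.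

Definition ext_even (K : fieldType) (U : vectType K) : {pred exterior U} :=
  [pred v : exterior U | [forall S : {set 'I_(\dim {:U})}, odd #|S| ==> (v S == 0)]].

Section EvenPart.

Context (K : fieldType) (U : vectType K).
Local Notation W := (exterior U).
Implicit Types (v w : W).

Lemma ext_evenP v : reflect (forall S : {set 'I_(\dim {:U})}, odd #|S| -> v S = 0) (v \in @ext_even K U).
Proof.
apply: (iffP forallP) => ev S; first by move=> oS; apply/eqP; move/implyP: (ev S); apply.
by apply/implyP => oS; rewrite ev.
Qed.

Lemma ext_power_even d v : v \in ext_power U d -> ~~ odd d -> v \in @ext_even K U.
Proof.
move=> /ext_powerP vd ed; apply/ext_evenP => S oS; apply: vd.
by apply: contraNneq ed => <-.
Qed.

Lemma ext_even_ind (P : W -> Prop) : P 0 ->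
    (forall c v w, P v -> P w -> P (c *: v + w)) ->
    (forall S : {set 'I_(\dim {:U})}, ~~ odd #|S| -> P (ext_basis S)) ->
  forall v, v \in @ext_even K U -> P v.
Proof.
move=> P0 PL PB v /ext_evenP ev; rewrite (ext_decomp v).
elim/big_ind: _ => // [y z Py Pz|S _]; first by rewrite -[y]scale1r; apply: PL.
case oS: (odd #|S|); first by rewrite ev // scale0r.
by rewrite -[_ *: _]addr0; apply: PL => //; apply: PB; rewrite oS.
Qed.

Lemma ext_even_lin c v w :
  v \in @ext_even K U -> w \in @ext_even K U -> c *: v + w \in @ext_even K U.
Proof.
move=> /ext_evenP ev /ext_evenP ew; apply/ext_evenP => S oS.
by rewrite !ffunE ev // ew // scaler0 addr0.
Qed.

Lemma ext_even0 : 0 \in @ext_even K U.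
Proof. by apply/ext_evenP => S _; rewrite ffunE. Qed.

Lemma ext_even_subring : subring_closed (@ext_even K U).
Proof.
split=> [|v w ev ew|v w ev ew].
- by apply: (ext_power_even (ext_power1 U)).
- by rewrite addrC -scaleN1r ext_even_lin.
move: v ev; apply: ext_even_ind => [|c v v' Pv Pv'|S eS].
- by rewrite mul0r ext_even0.
- by rewrite mulrDl -scalerAl ext_even_lin.
move: w ew; apply: ext_even_ind => [|c w w' Pw Pw'|T eT].
- by rewrite mulr0 ext_even0.
- by rewrite mulrDr -scalerAr ext_even_lin.
have := ext_powerM (@ext_power_basis K U S) (@ext_power_basis K U T).
by move/ext_power_even; apply; rewrite oddD (negPf eS) (negPf eT).
Qed.

HB.instance Definition _ := GRing.isSubringClosed.Build W (@ext_even K U) ext_even_subring.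

Lemma ext_even_comm v w : v \in @ext_even K U -> w \in @ext_even K U -> v * w = w * v.
Proof.
move=> ev ew; move: v ev; apply: ext_even_ind => [|c v v' Pv Pv'|S eS].
- by rewrite mul0r mulr0.
- by rewrite mulrDl mulrDr -scalerAl Pv Pv' -scalerAr.
move: w ew; apply: ext_even_ind => [|c w w' Pw Pw'|T eT].
- by rewrite mul0r mulr0.
- by rewrite mulrDl mulrDr -scalerAr Pw Pw' -scalerAl.
rewrite (ext_supercomm (@ext_power_basis K U S) (@ext_power_basis K U T)).
by rewrite -signr_odd oddM (negPf eS) scale1r.
Qed.

(** The even part as a commutative ring, over which determinants and the
    Cayley-Hamilton theorem are available. *)
Record even_ext := EvenExt { even_val : W; even_valP : even_val \in @ext_even K U }.

HB.instance Definition _ := [isSub for even_val].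
HB.instance Definition _ := [Choice of even_ext by <:].
HB.instance Definition _ := [SubChoice_isSubNzRing of even_ext by <:].

Lemma even_ext_mulC : commutative (@GRing.mul even_ext).
Proof. by move=> v w; apply/val_inj/ext_even_comm; apply: even_valP. Qed.

HB.instance Definition _ := GRing.PzRing_hasCommutativeMul.Build even_ext even_ext_mulC.

End EvenPart.

Lemma ext_power_gt (K : fieldType) (U : vectType K) d (v : exterior U) :
  (\dim {:U} < d)%N -> v \in ext_power U d -> v = 0.
Proof.
move=> ltd /ext_powerP vd; apply/ffunP => S; rewrite ffunE vd // neq_ltn.
by rewrite (leq_ltn_trans (max_card _)) // card_ord.
Qed.

(** With Y = x J, the matrix Y^2 has entries in the even part, is nilpotent for
    reasons of degree, and the traces of its positive powers are the vanishing
    loops of odd index; so (Y^2)^n = 0 by nilpotent_of_trace. *)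
Lemma arc_mx_vanish (K : fieldType) (U : vectType K) n
    (J : 'M[K]_n) (x : 'M[exterior U]_n) j :
    (forall m, (0 < m)%N -> m%:R != 0 :> K) ->
    (forall a b, x a b \in ext_power U 1) -> J^T = - J -> x^T = x ->
  (2 * n <= j)%N -> arc_mx J x j = 0.
Proof.
case: n J x => [|n] J x char0 x1 Jalt xsym lejn; first by apply/matrixP => -[].
pose Jw : 'M[exterior U]_n.+1 := \matrix_(a, b) (J a b)%:A.
have mulJ (v : exterior U) c : v * c%:A = c *: v by rewrite -scalerAr mulr1.
pose Y := x *m Jw.
have arcS (Z : 'M_n.+1) : twist J x Z = Y *m Z.
  apply/matrixP => a b; rewrite [LHS]mxE [RHS]mxE exchange_big; apply: eq_bigr => d _ /=.
  rewrite mxE mulr_suml; apply: eq_bigr => c _.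
  by rewrite [Jw _ _]mxE mulJ scalerAl.
have arcE i : arc_mx J x i = Y ^+ i *m x.
  elim: i => [|i IHi]; first by rewrite expr0 mul1mx.
  by rewrite -[arc_mx J x i.+1]/(twist J x (arc_mx J x i)) arcS IHi exprS mulmxA.
have YS i a b : (Y ^+ i.+1) a b = \sum_c J c b *: arc_mx J x i a c.
  rewrite exprSr [_ * _]mulmxA -arcE mxE; apply: eq_bigr => c _.
  by rewrite [Jw _ _]mxE mulJ.
have Ypow i a b : (Y ^+ i.+1) a b \in ext_power U i.+1.
  by rewrite YS; apply: memv_suml => c _; rewrite memvZ // arc_mx_power.
have Yeven a b : (Y ^+ 2) a b \in @ext_even K U by apply: ext_power_even (Ypow 1%N a b) _.
pose A : 'M[even_ext U]_n.+1 := \matrix_(a, b) EvenExt (Yeven a b).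
have valA : map_mx val A = Y ^+ 2 by apply/matrixP => a b; rewrite !mxE.
have valAX i : map_mx val (A ^+ i) = Y ^+ (2 * i) by rewrite rmorphXn /= valA exprM.
have AN0 : A ^+ (\dim {:U}).+1 = 0.
  apply/matrixP => a b; apply: val_inj.
  have -> : val ((A ^+ (\dim {:U}).+1) a b) = map_mx val (A ^+ (\dim {:U}).+1) a b.
    by rewrite mxE.
  rewrite valAX mxE mulnS add2n; apply: ext_power_gt (Ypow _ a b).
  by rewrite !ltnS leqW // mul2n -addnn leq_addr.
have trA i : (0 < i)%N -> \tr (A ^+ i) = 0.
  case: i => // i _; apply: val_inj.
  transitivity (\tr (Y ^+ (2 * i.+1))).
    by rewrite -valAX trace_map_mx.
  rewrite mulnS add2n /mxtrace; under eq_bigr do rewrite YS.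
  transitivity (- loop J x (2 * i).+1).
    rewrite -sumrN; apply: eq_bigr => a _; rewrite -sumrN; apply: eq_bigr => c _.
    rewrite -scaleNr; have := congr1 (fun M : 'M_n.+1 => M a c) Jalt.
    by rewrite !mxE => ->.
  by rewrite (loop_odd x1 Jalt char0) ?oppr0 //= oddM.
have /(congr1 (map_mx val)) : A ^+ n.+1 = 0.
  apply: nilpotent_of_trace AN0 trA => m v m0 /(congr1 val).
  rewrite raddfMn raddf0 -scaler_nat => /eqP.
  by rewrite scaler_eq0 (negPf (char0 _ m0)) => /eqP v0; apply: val_inj.
rewrite valAX map_mx0 => YN.
by rewrite arcE -(subnK lejn) exprD YN mulr0 mul0mx.
Qed.

(** * Contracting products of matrix entries *)

Section ArcProducts.

Context (C : numClosedFieldType) (U : vectType C) (n : nat) (I : finType).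
Local Notation W := (exterior U).
Local Notation word := {ffun I -> 'I_n}.
Context (J : 'M[C]_n) (x : 'M[W]_n).
Implicit Types (w : word) (T : word -> C) (A : {set I}) (i j p q : I).
Implicit Types (s : seq (nat * I * I)).

(** Summing over all words and then over the letter in slot i counts each word
    n times: (w, c) |-> (put w i c, w i) is an involution of the pairs. *)
Lemma sum_put (V : lmodType C) (F : word -> V) i :
  \sum_w \sum_c F (put w i c) = n%:R *: \sum_w F w.
Proof.
rewrite pair_bigA /=.
pose phi (u : word * 'I_n) := (put u.1 i u.2, u.1 i).
have phiK : involutive phi by case=> w c; rewrite /phi /= put_put put_id put_eq.
rewrite (reindex_inj (inv_inj phiK)) /= -(pair_bigA _ (fun w c => F (put (put w i c) i (w i)))) /=.
rewrite scaler_sumr; apply: eq_bigr => w _.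
under eq_bigr do rewrite put_put put_id.
by rewrite sumr_const card_ord scaler_nat.
Qed.

(** An element (a, p, q) of the list s stands for the factor arc_mx a with its
    row and column indices read from the slots p and q of a word. *)
Definition arc_names s : seq I := flatten [seq [:: a.1.2; a.2] | a <- s].
Definition arc_prod s w : W := \prod_(a <- s) arc_mx J x a.1.1 (w a.1.2) (w a.2).
Definition arc_deg s : nat := \sum_(a <- s) a.1.1.+1.
Definition arc_eval s T : W := \sum_w T w *: arc_prod s w.

Hypothesis x_deg1 : forall a b, x a b \in ext_power U 1.
Hypothesis (Jalt : J^T = - J) (JJ : J *m J = - 1%:M) (xsym : x^T = x).

Lemma arc_prod_power s w : arc_prod s w \in ext_power U (arc_deg s).
Proof.
rewrite /arc_prod /arc_deg; elim: s => [|a s IHs]; first by rewrite !big_nil ext_power1.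
by rewrite !big_cons ext_powerM // arc_mx_power.
Qed.

(** Entries are homogeneous, so factors can be reordered, and arcs reversed, at
    the cost of a sign that does not depend on the word. *)
Lemma arc_front s i : i \in arc_names s ->
  exists c a q s', [/\ forall w, arc_prod s w = c *: (arc_mx J x a (w i) (w q) * arc_prod s' w),
    perm_eq (arc_names s) [:: i, q & arc_names s'] & arc_deg s = (a.+1 + arc_deg s')%N].
Proof.
case/flatten_mapP => -[[a p] q] /splitPr[s1 s2] pq.
have front c p' q' : (forall w, arc_mx J x a (w p) (w q) = c *: arc_mx J x a (w p') (w q')) ->
  forall w, arc_prod (s1 ++ (a, p, q) :: s2) w =
    ((-1) ^+ (arc_deg s1 * a.+1) * c) *: (arc_mx J x a (w p') (w q') * arc_prod (s1 ++ s2) w).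
  move=> arcE w; rewrite /arc_prod big_cat big_cons /= mulrA.
  rewrite (ext_supercomm (arc_prod_power s1 w) (arc_mx_power J x_deg1 a (w p) (w q))).
  by rewrite arcE big_cat /= -!scalerAl !scalerA mulrA.
have degE : arc_deg (s1 ++ (a, p, q) :: s2) = (a.+1 + arc_deg (s1 ++ s2))%N.
  by rewrite /arc_deg !big_cat big_cons /= addnCA.
have namesE : perm_eq (arc_names (s1 ++ (a, p, q) :: s2)) [:: p, q & arc_names (s1 ++ s2)].
  rewrite /arc_names !map_cat !flatten_cat /=.
  by rewrite (perm_catCA _ [:: p; q] _).
have {pq} [->|->] : i = p \/ i = q.
  by move: pq; rewrite !inE => /orP[] /eqP; [left | right].
  exists ((-1) ^+ (arc_deg s1 * a.+1) * 1), a, q, (s1 ++ s2); split => //.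
  by apply: front => w; rewrite scale1r.
exists ((-1) ^+ (arc_deg s1 * a.+1) * (-1) ^+ 'C(a, 2)), a, p, (s1 ++ s2); split => //.
  by apply: front => w; apply: arc_mx_sym.
by rewrite (perm_trans namesE) // (perm_catCA [:: p] [:: q] _).
Qed.

Lemma put_depends i j A T w c d : i != j -> depends_on (A :\ i :\ j) T ->
  T (put (put w i c) j d) = T w.
Proof.
move=> ij dT; apply: dT => k; rewrite !inE => /and3P[kj ki _].
by rewrite !put_neq.
Qed.

Lemma arc_prod_put s w i c : i \notin arc_names s -> arc_prod s (put w i c) = arc_prod s w.
Proof.
elim: s => [|[[a p] q] s IHs]; first by rewrite /arc_prod !big_nil.
rewrite /arc_names /= !inE !negb_or => /and3P[ip iq /IHs].
rewrite /arc_prod !big_cons /= => ->.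
by rewrite !put_neq // eq_sym.
Qed.

Context (P : nat -> {vspace W}).
Hypotheses (P1 : 1 \in P 0)
  (Ploop : forall (a d : nat) v, v \in P d -> loop J x a * v \in P (a.+1 + d)%N).
Hypothesis n_gt0 : (0 < n)%N.

(** The family of tensors to which fft_sp is applied. *)
Definition arc_good A T := forall s, uniq (arc_names s) ->
  (forall i, (i \in arc_names s) = (i \in A)) -> arc_eval s T \in P (arc_deg s).

(** If i and j are the two ends of one arc, summing over their letters closes it
    into a loop; otherwise it joins the two arcs that end in i and j into one,
    and the number of slots drops by two. *)
Lemma arc_good_pair A i j T : i \in A -> j \in A -> i != j ->
  depends_on (A :\ i :\ j) T -> arc_good (A :\ i :\ j) T ->
  arc_good A (fun w => J (w i) (w j) * T w).
Proof.
move=> Ai Aj ij dT gT s us As.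
have ji : j != i by rewrite eq_sym.
have nn0 : (n%:R * n%:R : C) != 0 by rewrite mulf_neq0 // pnatr_eq0 -lt0n.
(* As T does not depend on the slots i and j, sum over their letters first. *)
have average (F : word -> W) d :
    \sum_w \sum_c \sum_d F (put (put w i c) j d) \in P d -> \sum_w F w \in P d.
  move=> sumP; rewrite -[\sum_w F w](scalerK nn0) memvZ // -scalerA.
  by rewrite -(sum_put F j) -(sum_put (fun w => \sum_d F (put w j d)) i).
have [c [a [q [s1 [s1E s1n ->]]]]] : exists c a q s', [/\
    forall w, arc_prod s w = c *: (arc_mx J x a (w i) (w q) * arc_prod s' w),
    perm_eq (arc_names s) [:: i, q & arc_names s'] & arc_deg s = (a.+1 + arc_deg s')%N].
  by apply: arc_front; rewrite As.
have [/and3P[]] : uniq [:: i, q & arc_names s1] /\ forall k,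
    (k \in [:: i, q & arc_names s1]) = (k \in A).
  by split=> [|k]; rewrite -?(perm_uniq s1n) -?(perm_mem s1n).
rewrite inE negb_or => /andP[iq is1] qs1 us1 mem1.
apply: average; have [qj|qj] := eqVneq q j.
  subst q.
  have -> : \sum_w \sum_(c0 < n) \sum_(d < n)
       (J (put (put w i c0) j d i) (put (put w i c0) j d j) * T (put (put w i c0) j d))
          *: arc_prod s (put (put w i c0) j d) = c *: (loop J x a * arc_eval s1 T).
    rewrite /arc_eval mulr_sumr scaler_sumr; apply: eq_bigr => w _.
    rewrite -scalerAr scalerA /loop mulr_suml scaler_sumr; apply: eq_bigr => e _.
    rewrite mulr_suml scaler_sumr; apply: eq_bigr => d _.
    rewrite s1E put_eq !(put_neq _ _ ij) !put_eq (put_depends w e d ij dT).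
    rewrite !arc_prod_put // scalerA -scalerAl scalerA; congr (_ *: _).
    by rewrite mulrAC [RHS]mulrC mulrA.
  rewrite memvZ // Ploop // gT // => k; have := mem1 k; rewrite !inE.
  case: (eqVneq k i) => [->|ki]; first by rewrite (negPf is1) andbF.
  by case: (eqVneq k j) => [->|kj] //=; rewrite (negPf qs1).
have js1 : j \in arc_names s1.
  by have := mem1 j; rewrite Aj !inE (negPf ji) eq_sym (negPf qj).
have [c' [b [r [s2 [s2E s2n s2d]]]]] := arc_front js1.
have [/and3P[]] : uniq [:: j, r & arc_names s2] /\ forall k,
    (k \in [:: j, r & arc_names s2]) = (k \in arc_names s1).
  by split=> [|k]; rewrite -?(perm_uniq s2n) -?(perm_mem s2n).
rewrite inE negb_or => /andP[jr js2] rs2 us2 mem2.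
have ir : r != i by apply: contraNneq is1 => <-; rewrite -mem2 !inE eqxx orbT.
have is2 : i \notin arc_names s2.
  by apply: contra is1; rewrite -mem2 !inE => ->; rewrite !orbT.
have qr : q != r by apply: contraNneq qs1 => ->; rewrite -mem2 !inE eqxx orbT.
have qs2 : q \notin arc_names s2.
  by apply: contra qs1; rewrite -mem2 !inE => ->; rewrite !orbT.
have -> : \sum_w \sum_(c0 < n) \sum_(d < n)
     (J (put (put w i c0) j d i) (put (put w i c0) j d j) * T (put (put w i c0) j d))
        *: arc_prod s (put (put w i c0) j d) =
    (c * c' * (-1) ^+ 'C(a, 2)) *: arc_eval (((a + b).+1, q, r) :: s2) T.
  rewrite /arc_eval scaler_sumr; apply: eq_bigr => w _.
  rewrite scalerA /arc_prod big_cons /= -(arc_mx_cat J x a b) mulr_suml scaler_sumr.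
  apply: eq_bigr => e _; rewrite mulr_suml scaler_sumr; apply: eq_bigr => d _.
  rewrite -!/(arc_prod _ _) s1E s2E put_eq !(put_neq _ _ ij) !put_eq (put_depends w e d ij dT).
  rewrite (put_neq _ _ qj) (put_neq _ _ (_ : q != i)) 1?eq_sym //.
  rewrite (put_neq _ _ (_ : r != j)) 1?eq_sym // (put_neq _ _ ir) !arc_prod_put //.
  rewrite (arc_mx_sym x_deg1 Jalt xsym a (w q) e) -!scalerAl -!scalerAr !scalerA mulrA.
  congr (_ *: _).
  ring.
rewrite memvZ // s2d.
have -> : (a.+1 + (b.+1 + arc_deg s2))%N = arc_deg (((a + b).+1, q, r) :: s2).
  by rewrite /arc_deg big_cons /= !addSn addnS addnA.
apply: gT => [|k]; rewrite /arc_names /= -/(arc_names s2).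
  by rewrite inE negb_or qr qs2 rs2; apply: us2.
have := mem1 k; have := mem2 k; rewrite !inE => <-.
case: (eqVneq k i) => [-> _|ki].
  by rewrite (negPf is2) (negPf iq) (eq_sym i r) (negPf ir) andbF.
case: (eqVneq k j) => [-> _|kj] //=.
by rewrite (negPf js2) (negPf jr) (eq_sym j q) (negPf qj).
Qed.

Theorem arc_eval_invariant T s : sp_killed J setT T ->
  uniq (arc_names s) -> (forall i, i \in arc_names s) ->
  arc_eval s T \in P (arc_deg s).
Proof.
move=> kT us ss.
suff gT : arc_good setT T by apply: gT => // i; rewrite ss inE.
apply: (fft_sp Jalt JJ (M := arc_good)) => //.
- by move=> A s' _ _; rewrite /arc_eval big1 ?mem0v // => w _; rewrite scale0r.
- move=> A c T1 T2 g1 g2 s' us' ms'.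
  rewrite (_ : arc_eval _ _ = c *: arc_eval s' T1 + arc_eval s' T2).
    by rewrite memvD ?memvZ ?g1 ?g2.
  rewrite /arc_eval scaler_sumr -big_split; apply: eq_bigr => w _ /=.
  by rewrite scalerDl scalerA.
- move=> A i j T' Ai Aj ij gT s' us' ms'.
  pose ren (a : nat * I * I) := (a.1.1, tperm i j a.1.2, tperm i j a.2).
  have namesE : arc_names (map ren s') = map (tperm i j) (arc_names s').
    by rewrite /arc_names map_flatten -!map_comp; congr flatten; apply: eq_map.
  have swapK : involutive (fun w : word => swap w i j).
    by move=> w; apply/ffunP => k; rewrite !ffunE tpermK.
  have -> : arc_eval s' (fun w => T' (swap w i j)) = arc_eval (map ren s') T'.
    rewrite /arc_eval (reindex_inj (inv_inj swapK)); apply: eq_bigr => w _ /=.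
    rewrite swapK; congr (_ *: _); rewrite /arc_prod big_map.
    by apply: eq_bigr => a _; rewrite !ffunE.
  have -> : arc_deg s' = arc_deg (map ren s') by rewrite /arc_deg big_map.
  apply: gT => [|k]; rewrite namesE; first by rewrite map_inj_uniq //; apply: perm_inj.
  rewrite -[k in LHS](tpermK i j) mem_map; last exact: perm_inj.
  by rewrite ms'; case: tpermP => [->|->|] //; rewrite Ai Aj.
- move=> [_ _|[[a p] q] s' _ ms']; last by have := ms' p; rewrite !inE eqxx.
  rewrite /arc_eval /arc_deg big_nil; apply: memv_suml => w _.
  by rewrite scale1r /arc_prod big_nil.
- by move=> A i j T' *; apply: arc_good_pair.
- by move=> w w' ww'; congr T; apply/ffunP => i; rewrite ww'.
Qed.

End ArcProducts.

(** * The exterior algebra of the symmetric square *)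

Section SymSquare.

Context (K : fieldType) (n : nat).
Local Notation U := (sym2 K n).
Implicit Types (a b c d : 'I_n) (g : 'M[K]_n).

Lemma monom2_homog a b : 'X_a * 'X_b \is [in K[n], 2.-homog].
Proof. by rewrite (dhomogM (d := 1) (e := 1)) // dhomogX /= mdeg1. Qed.

Definition monom2 a b : U := DHomog (monom2_homog a b).

Lemma monom2C a b : monom2 a b = monom2 b a.
Proof. by apply/val_inj; rewrite /= mulrC. Qed.

Lemma val_sym2_sum (X : Type) (r : seq X) (F : X -> U) :
  val (\sum_(k <- r) F k) = \sum_(k <- r) val (F k).
Proof. exact: (big_morph (val : U -> {mpoly K[n]}) (fun _ _ => erefl) erefl). Qed.

Lemma sym2_span (u : U) : exists B : 'I_n -> 'I_n -> K,
  u = \sum_a \sum_b B a b *: monom2 a b.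
Proof.
have span0 : exists B : 'I_n -> 'I_n -> K, 0 = \sum_a \sum_b B a b *: monom2 a b.
  by exists (fun _ _ => 0); rewrite big1 // => a _; rewrite big1 // => b _; rewrite scale0r.
have spanL (c : K) v w : (exists B : 'I_n -> 'I_n -> K, v = \sum_a \sum_b B a b *: monom2 a b) ->
    (exists B : 'I_n -> 'I_n -> K, w = \sum_a \sum_b B a b *: monom2 a b) ->
    exists B : 'I_n -> 'I_n -> K, c *: v + w = \sum_a \sum_b B a b *: monom2 a b.
  case=> B -> [B' ->]; exists (fun a b => c * B a b + B' a b).
  rewrite scaler_sumr -big_split; apply: eq_bigr => a _ /=.
  rewrite scaler_sumr -big_split; apply: eq_bigr => b _ /=.
  by rewrite scalerDl scalerA.
have span1 a b : exists B : 'I_n -> 'I_n -> K, monom2 a b = \sum_a \sum_b B a b *: monom2 a b.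
  exists (fun a' b' => ((a' == a) && (b' == b))%:R).
  rewrite (bigD1 a) //= (bigD1 b) //= !eqxx scale1r !big1 ?addr0 // => [a' /negPf na|b' /negPf nb].
    by rewrite big1 // => b' _; rewrite na scale0r.
  by rewrite nb scale0r.
have deg2 (m : 'X_{1..n}) : mdeg m = 2 -> exists a b, 'X_[m] = 'X_a * 'X_b :> {mpoly K[n]}.
  move=> m2; have [a ma] : exists a, (U_(a) <= m)%MM.
    suff [a ma] : exists a, m a != 0%N by exists a; rewrite lep1mP.
    apply/existsP; apply: contraPT m2; rewrite negb_exists => /forallP m0.
    rewrite mdegE big1 // => a _; have := m0 a; rewrite negbK => /eqP //.
  have : mdeg (m - U_(a))%MM == 1%N.
    by rewrite -(eqn_add2r (mdeg U_(a)%MM)) -mdegD submK // m2 mdeg1.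
  case/mdeg1P => b /eqP mb; exists b, a.
  by rewrite -mpolyXD -mb submK.
have main (r : seq 'X_{1..n}) (F : 'X_{1..n} -> K) : (forall m, m \in r -> mdeg m = 2) ->
    exists v : U, val v = \sum_(m <- r) F m *: 'X_[m] /\
      exists B : 'I_n -> 'I_n -> K, v = \sum_a \sum_b B a b *: monom2 a b.
  elim: r => [|m r IHr] r2; first by exists 0; rewrite big_nil.
  case: IHr => [m' m'r|v [vE vB]]; first by apply: r2; rewrite inE m'r orbT.
  have [|a [b mE]] := deg2 m; first by apply: r2; rewrite inE eqxx.
  exists (F m *: monom2 a b + v); split; last exact: spanL.
  by rewrite big_cons -vE mE.
case: (main (msupp (val u)) (fun m => (val u)@_m)).
  by have /dhomogP := valP u; apply.
move=> v [vE vB]; suff -> : u = v by [].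
by apply/val_inj; rewrite vE [LHS]mpolyE.
Qed.

Lemma sym2_act_monom g a b :
  sym2_act g (monom2 a b) = \sum_c \sum_d (g c a * g d b) *: monom2 c d.
Proof.
apply/val_inj; rewrite val_sym2_sum.
under eq_bigr do rewrite val_sym2_sum.
rewrite /= rmorphM /= !comp_mpolyXU -!tnth_nth !tnth_mktuple mulr_suml.
apply: eq_bigr => c _; rewrite mulr_sumr; apply: eq_bigr => d _ /=.
by rewrite -scalerAl -scalerAr scalerA.
Qed.

Lemma lin_subst_comp g h a :
  ('X_a \mPo lin_subst h) \mPo lin_subst g = 'X_a \mPo lin_subst (g *m h).
Proof.
rewrite !comp_mpolyXU -!tnth_nth !tnth_mktuple linear_sum.
transitivity (\sum_c \sum_d (h c a * g d c) *: 'X_d : {mpoly K[n]}).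
  apply: eq_bigr => c _; rewrite linearZ /= comp_mpolyXU -tnth_nth tnth_mktuple.
  by rewrite scaler_sumr; apply: eq_bigr => d _; rewrite scalerA.
rewrite exchange_big; apply: eq_bigr => d _ /=; rewrite mxE scaler_suml.
by apply: eq_bigr => c _; rewrite mulrC.
Qed.

Lemma sym2_act_comp g h : sym2_act (g *m h) =1 sym2_act g \o sym2_act h.
Proof.
move=> u; have [B ->] := sym2_span u; rewrite /= !linear_sum; apply: eq_bigr => a _.
rewrite !linear_sum; apply: eq_bigr => b _; rewrite !linearZ /=; congr (_ *: _).
by apply/val_inj; rewrite /= !rmorphM /= !lin_subst_comp.
Qed.

Lemma sym2_act1 : sym2_act 1%:M =1 idfun :> (U -> U).
Proof.
move=> u; have [B ->] := sym2_span u; rewrite !linear_sum; apply: eq_bigr => a _.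
rewrite !linear_sum; apply: eq_bigr => b _; rewrite !linearZ /=; congr (_ *: _).
rewrite sym2_act_monom (bigD1 a) //= (bigD1 b) //= !mxE !eqxx mulr1 scale1r.
rewrite !big1 ?addr0 // => [c /negPf ca|d /negPf db].
  by rewrite big1 // => d _; rewrite mxE ca mul0r scale0r.
by rewrite [_ d b]mxE db mulr0 scale0r.
Qed.

Lemma dim_sym2 : \dim {:U} = 'C(n.+1, 2).
Proof. by rewrite dimvf. Qed.

End SymSquare.

Section Generic.

Context (C : numClosedFieldType) (n : nat).
Local Notation U := (sym2 C n).
Local Notation W := (exterior U).

Definition gen_mx : 'M[W]_n := \matrix_(a, b) ext_iota (monom2 C a b).

Lemma gen_mx_deg1 a b : gen_mx a b \in ext_power U 1.
Proof. by rewrite mxE ext_iota_power. Qed.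

Lemma gen_mx_sym : gen_mx^T = gen_mx.
Proof. by apply/matrixP => a b; rewrite !mxE monom2C. Qed.

Lemma act_gen_mx g a b :
  ext_sym2_act g (gen_mx a b) = \sum_c \sum_d (g c a * g d b) *: gen_mx c d.
Proof.
rewrite mxE /ext_sym2_act ext_map_iota /= sym2_act_monom linear_sum.
apply: eq_bigr => c _; rewrite linear_sum; apply: eq_bigr => d _.
by rewrite linearZ /= mxE.
Qed.

Section TensorsToForms.

Context (d : nat).
Local Notation slot := ('I_d * bool)%type.
Local Notation word := {ffun slot -> 'I_n}.
Implicit Types (w : word) (T : word -> C).

(** The projection from tensors with 2d slots onto the d-th exterior power of
    S^2 V; the slots (l, false) and (l, true) hold the l-th factor. *)
Definition tens_to_ext T : W :=
  \sum_(w : word) T w *: \prod_l gen_mx (w (l, false)) (w (l, true)).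

(** Expanding a product over l of sums over pairs of letters is summing over
    words with two slots for each l. *)
Lemma prod_sum_words (R : nzSemiRingType) (F : 'I_d -> 'I_n -> 'I_n -> R) :
  \prod_l \sum_a \sum_b F l a b = \sum_(w : word) \prod_l F l (w (l, false)) (w (l, true)).
Proof.
under eq_bigr do rewrite pair_bigA /=.
rewrite bigA_distr_bigA /=.
pose enc (w : word) : {ffun 'I_d -> 'I_n * 'I_n} := [ffun l => (w (l, false), w (l, true))].
pose dec (f : {ffun 'I_d -> 'I_n * 'I_n}) : word :=
  [ffun p => if p.2 then (f p.1).2 else (f p.1).1].
have encK : cancel enc dec by move=> w; apply/ffunP => -[l []]; rewrite !ffunE.
have decK : cancel dec enc.
  by move=> f; apply/ffunP => l; rewrite !ffunE /=; case: (f l).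
rewrite (reindex enc); last by exists dec => ? _; [apply: encK | apply: decK].
by apply: eq_bigr => w _; apply: eq_bigr => l _; rewrite ffunE.
Qed.

Lemma tens_to_ext_lin c T T' :
  tens_to_ext (fun w => c * T w + T' w) = c *: tens_to_ext T + tens_to_ext T'.
Proof.
rewrite /tens_to_ext scaler_sumr -big_split; apply: eq_bigr => w _ /=.
by rewrite scalerDl scalerA.
Qed.

Lemma tens_to_ext_act g T : tens_to_ext (tens_act g T) = ext_sym2_act g (tens_to_ext T).
Proof.
rewrite /tens_to_ext linear_sum /=.
transitivity (\sum_(w : word) \sum_(u : word) ((\prod_i g (w i) (u i)) * T u) *:
   \prod_l gen_mx (w (l, false)) (w (l, true))).
  by apply: eq_bigr => w _; rewrite scaler_suml.
rewrite exchange_big; apply: eq_bigr => u _ /=.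
rewrite linearZ /= /ext_sym2_act ext_map_prod.
under [X in _ = _ *: X]eq_bigr do rewrite -/(ext_sym2_act g _) act_gen_mx.
rewrite (prod_sum_words (fun l a b => (g a (u (l, false)) * g b (u (l, true))) *: gen_mx a b)).
rewrite scaler_sumr; apply: eq_bigr => w _; rewrite scaler_prod scalerA mulrC.
congr (_ * _ *: _).
transitivity (\prod_l \prod_e g (w (l, e)) (u (l, e))).
  by rewrite pair_bigA; apply: eq_bigr => -[l e].
by apply: eq_bigr => l _; rewrite big_bool mulrC.
Qed.

Lemma tens_to_ext_surj v : v \in ext_power U d -> exists T, v = tens_to_ext T.
Proof.
move: v; apply: ext_power_ind => [|c _ _ [T ->] [T' ->]|S Sd].
- by exists (fun=> 0); rewrite /tens_to_ext big1 // => w _; rewrite scale0r.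
- by exists (fun w => c * T w + T' w); rewrite tens_to_ext_lin.
have [B BE] : exists B : U -> 'I_n -> 'I_n -> C,
    forall u, u = \sum_a \sum_b B u a b *: monom2 C a b.
  by exists (fun u => projT1 (cid (sym2_span u))) => u; case: cid.
rewrite ext_basisE -(big_map (fun i : 'I__ => (vbasis {:U})`_i) xpredT (@ext_iota C U)).
set e := map _ _; have ed : size e = d by rewrite size_map -cardE.
rewrite (big_nth 0) ed big_mkord.
under eq_bigr => l _.
  rewrite (BE e`_l) linear_sum; under eq_bigr do rewrite linear_sum.
  under eq_bigr do under eq_bigr do rewrite linearZ /=.
  over.
rewrite (prod_sum_words (fun l a b => B e`_l a b *: ext_iota (monom2 C a b))).
exists (fun w : word => \prod_(l < d) B e`_l (w (l, false)) (w (l, true))).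
apply: eq_bigr => w _; rewrite scaler_prod; congr (_ *: _).
by apply: eq_bigr => l _; rewrite mxE.
Qed.

End TensorsToForms.
End Generic.

(** * Products of odd elements *)

Section OddGenerators.

Context (K : fieldType) (U : vectType K) (k : nat).
Local Notation W := (exterior U).
Context (y : 'I_k -> W) (deg : 'I_k -> nat).
Hypothesis y_deg : forall i, y i \in ext_power U (deg i).
Hypothesis y_sqr : forall i, y i * y i = 0.

Implicit Types (s t : seq 'I_k) (S T : {set 'I_k}).

Definition set_deg S : nat := (\sum_(i in S) deg i)%N.
Definition set_prod S : W := \prod_(i <- enum S) y i.
Definition set_span d : {vspace W} :=
  <<[seq set_prod A | A : {set 'I_k} <- enum [set B : {set 'I_k} | set_deg B == d]]>>%VS.

Lemma prod_power s : \prod_(i <- s) y i \in ext_power U (\sum_(i <- s) deg i)%N.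
Proof.
elim: s => [|i s IHs]; first by rewrite !big_nil ext_power1.
by rewrite !big_cons ext_powerM.
Qed.

Lemma prod_perm s t : perm_eq s t ->
  exists e : nat, \prod_(i <- s) y i = (-1) ^+ e *: \prod_(i <- t) y i.
Proof.
elim: s t => [|i s IHs] t.
  by rewrite perm_sym => /perm_nilP ->; exists 0; rewrite scale1r.
move=> st; have : i \in t by rewrite -(perm_mem st) inE eqxx.
move: st => /[swap] /splitPr[t1 t2] st.
have {}st : perm_eq s (t1 ++ t2).
  by move: st; rewrite perm_sym (perm_catCA t1 [:: i] t2) /= perm_cons perm_sym.
have [e sE] := IHs _ st.
exists (e + deg i * \sum_(j <- t1) deg j)%N.
rewrite big_cons sE big_cat /= big_cat big_cons /= mulrA -[in RHS]mulrA.
rewrite [in RHS]mulrA (ext_supercomm (prod_power t1) (y_deg i)) -scalerAl.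
rewrite -scalerAr mulrA scalerA; congr (_ *: _).
by rewrite exprD mulnC -mulrA -expr2 sqrr_sign mulr1.
Qed.

Lemma prod_dup s : ~~ uniq s -> \prod_(i <- s) y i = 0.
Proof.
elim: s => //= i s IHs; rewrite negb_and negbK big_cons.
case/orP => [|/IHs ->]; last by rewrite mulr0.
move=> /perm_to_rem /prod_perm[e ->]; rewrite big_cons -scalerAr mulrA y_sqr mul0r.
by rewrite scaler0.
Qed.

Lemma mul_set_prod S T : set_prod S * set_prod T =
   \prod_(i <- enum S ++ enum T) y i.
Proof. by rewrite big_cat. Qed.

Lemma mul_set_prod0 S T : ~~ [disjoint S & T] -> set_prod S * set_prod T = 0.
Proof.
rewrite mul_set_prod => /pred0Pn[i /andP[/= iS iT]]; apply: prod_dup.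
rewrite cat_uniq negb_and negb_and negbK; apply/orP; right; apply/orP; left.
by apply/hasP; exists i; rewrite mem_enum.
Qed.

Lemma mul_set_prodU S T : [disjoint S & T] ->
  exists e : nat, set_prod S * set_prod T = (-1) ^+ e *: set_prod (S :|: T).
Proof.
move=> dST; rewrite mul_set_prod; apply: prod_perm; apply: uniq_perm.
- rewrite cat_uniq !enum_uniq andbT /=; apply/hasPn => i; rewrite !mem_enum => iT.
  by apply/negP => iS; move/pred0P: dST => /(_ i) /=; rewrite iS iT.
- exact: enum_uniq.
- by move=> i; rewrite mem_cat !mem_enum inE.
Qed.

Lemma set_prod_power S : set_prod S \in ext_power U (set_deg S).
Proof. by rewrite /set_deg -big_enum; apply: prod_power. Qed.

Lemma set_span_power d v : v \in set_span d -> v \in ext_power U d.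
Proof.
apply: subvP v; apply/span_subvP => _ /mapP[S + ->].
by rewrite mem_enum inE => /eqP <-; apply: set_prod_power.
Qed.

Lemma set_prod_span S : set_prod S \in set_span (set_deg S).
Proof. by apply/memv_span/map_f; rewrite mem_enum inE. Qed.

Lemma mul_set_span i d v : v \in set_span d -> y i * v \in set_span (deg i + d)%N.
Proof.
rewrite {1}/set_span; set X := map _ _ => vX; rewrite (coord_span (X := in_tuple X) vX).
rewrite mulr_sumr; apply: memv_suml => l _; rewrite -scalerAr memvZ //.
have : (in_tuple X)`_l \in X by apply: mem_nth.
case/mapP => S; rewrite mem_enum inE => /eqP <- ->.
have y1 : y i = set_prod [set i] by rewrite /set_prod enum_set1 big_seq1.
have d1 : deg i = set_deg [set i] by rewrite /set_deg big_set1.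
rewrite y1; have [dS|dS] := boolP [disjoint [set i] & S]; last first.
  by rewrite mul_set_prod0 ?mem0v.
have [c ->] := mul_set_prodU dS; rewrite memvZ // d1.
rewrite (_ : (_ + _)%N = set_deg ([set i] :|: S)) ?set_prod_span //.
by rewrite /set_deg big_set1 big_setU1 // -disjoints1.
Qed.

Hypothesis full_neq0 : set_prod setT != 0.

(** Duality: multiplying by the product over the complement of A leaves only the
    terms indexed by subsets of A, and those indexed by proper subsets vanish by
    induction on the size of A. *)
Lemma set_prod_free (c : {set 'I_k} -> K) :
  \sum_A c A *: set_prod A = 0 -> forall A, c A = 0.
Proof.
move=> c0 A; have [m] := ubnP #|A|; elim: m A => // m IHm A leAm.
have := congr1 (fun v => set_prod (~: A) * v) c0; rewrite mulr0 mulr_sumr.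
rewrite (bigD1 A) //= big1 => [|B BA].
  have dA : [disjoint ~: A & A] by rewrite disjoints_subset.
  rewrite addr0 -scalerAr; have [e ->] := mul_set_prodU dA.
  rewrite setUC setUCr scalerA => /eqP.
  by rewrite scaler_eq0 (negPf full_neq0) orbF mulf_eq0 signr_eq0 orbF => /eqP.
rewrite -scalerAr; have [sBA|sBA] := boolP (B \subset A).
  rewrite IHm ?scale0r //; rewrite ltnS in leAm; apply: leq_trans leAm.
  by apply: proper_card; rewrite properEneq BA.
by rewrite mul_set_prod0 ?scaler0 // disjoint_sym disjoints_subset setCK.
Qed.

Lemma dim_set_span d : \dim (set_span d) = #|[set A : {set 'I_k} | set_deg A == d]|.
Proof.
set D := [set _ | _]; pose X := [seq set_prod A | A : {set 'I_k} <- enum D].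
suff /eqP -> : free X by rewrite size_map -cardE.
apply/(@freeP _ _ _ (in_tuple X)) => c c0 l0.
have ltX (l : 'I_(size X)) : (l < size (enum D))%N.
  by apply: leq_trans (ltn_ord l) _; rewrite size_map.
pose elt (l : 'I_(size X)) := nth set0 (enum D) l.
pose h A := \sum_(l | elt l == A) c l.
have /set_prod_free /(_ (elt l0)) : \sum_A h A *: set_prod A = 0.
  rewrite -[RHS]c0; under eq_bigr do rewrite scaler_suml.
  rewrite (exchange_big_dep predT) //=; apply: eq_bigr => l _.
  rewrite (big_pred1 (elt l)) => [|A]; last by rewrite /= eq_sym.
  by rewrite /= (nth_map set0) ?ltX.
rewrite /h (big_pred1 l0) // => l; rewrite /elt nth_uniq ?enum_uniq //.
Qed.

End OddGenerators.

(** * Symplectic invariants *)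

Section SymplecticForm.

Context (K : fieldType) (k : nat).
Local Notation J := (symplectic_form K k).

Lemma symplectic_form_alt : J^T = - J.
Proof. by rewrite tr_block_mx !trmx0 linearN /= trmx1 opp_block_mx !oppr0 opprK. Qed.

Lemma symplectic_form_sqr : J *m J = - 1%:M.
Proof.
rewrite mulmx_block !(mulmx0, mul0mx, mul1mx, mulmx1, oppr0, addr0, add0r).
by rewrite [in RHS]scalar_mx_block opp_block_mx oppr0.
Qed.

(** From g^T J g = J, the matrix - J g^T J is a left inverse of g, hence a right
    inverse. *)
Lemma sp_trmx (g : 'M[K]_(k + k)) : g \in Sp K k -> g *m J *m g^T = J.
Proof.
rewrite inE => /andP[_ /eqP gJg].
have : (- (J *m g^T *m J)) *m g = 1%:M.
  by rewrite mulNmx -!mulmxA [g^T *m _]mulmxA gJg symplectic_form_sqr opprK.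
move/mulmx1C; rewrite mulmxN !mulmxA => /(congr1 (fun M => M *m J)).
rewrite mul1mx mulNmx -!mulmxA symplectic_form_sqr.
by rewrite !mulmxN mulmx1 opprK.
Qed.

End SymplecticForm.

Section Invariance.

Context (C : numClosedFieldType) (n : nat) (J : 'M[C]_n).
Local Notation U := (sym2 C n).
Local Notation W := (exterior U).
Local Notation x := (gen_mx C n).

Lemma conjugate_coef (g : 'M[C]_n) (Z : 'M[W]_n) a b :
  (map_mx (in_alg W) g^T *m Z *m map_mx (in_alg W) g) a b =
    \sum_c \sum_d (g c a * g d b) *: Z c d.
Proof.
rewrite [LHS]mxE [RHS]exchange_big; apply: eq_bigr => d _; rewrite mxE mulr_suml.
apply: eq_bigr => c _; rewrite !mxE /= -scalerAl mul1r -scalerAr mulr1 scalerA.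
by rewrite mulrC.
Qed.

(** The action turns x into g^T x g, so each factor J of an arc becomes
    g J g^T = J. *)
Lemma act_arc_mx (g : 'M[C]_n) : g *m J *m g^T = J -> forall j,
  map_mx (ext_sym2_act g) (arc_mx J x j) =
    map_mx (in_alg W) g^T *m arc_mx J x j *m map_mx (in_alg W) g.
Proof.
move=> gJg; set Gt := map_mx _ g^T; set G := map_mx _ g.
have twistE Z : twist J x Z = x *m map_mx (in_alg W) J *m Z.
  apply/matrixP => a b; rewrite [LHS]mxE [RHS]mxE exchange_big; apply: eq_bigr => d _ /=.
  rewrite mxE mulr_suml; apply: eq_bigr => c _.
  by rewrite [map_mx _ _ _ _]mxE /= -scalerAr mulr1 scalerAl.
have act0 : map_mx (ext_sym2_act g) x = Gt *m x *m G.
  by apply/matrixP => a b; rewrite conjugate_coef mxE act_gen_mx.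
elim=> [//|j IHj].
have actM (A B : 'M[W]_n) : map_mx (ext_sym2_act g) (A *m B) =
    map_mx (ext_sym2_act g) A *m map_mx (ext_sym2_act g) B.
  apply/matrixP => a b; rewrite !mxE linear_sum; apply: eq_bigr => c _.
  by rewrite !mxE; apply: ext_mapM.
have actJ : map_mx (ext_sym2_act g) (map_mx (in_alg W) J) = map_mx (in_alg W) J.
  apply/matrixP => a b; rewrite !mxE /= linearZ /=; congr (_ *: _).
  exact: ext_map1.
rewrite -[arc_mx J x j.+1]/(twist J x (arc_mx J x j)) twistE !actM act0 actJ IHj.
have gJgW : G *m map_mx (in_alg W) J *m Gt = map_mx (in_alg W) J.
  by rewrite -!map_mxM gJg.
have assoc (A B D E Jm : 'M[W]_n) : B *m Jm *m A = Jm ->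
    (A *m D *m B) *m Jm *m (A *m E *m B) = A *m (D *m Jm *m E) *m B.
  by move=> H; rewrite -[in RHS]H !mulmxA.
exact: assoc gJgW.
Qed.

Lemma act_loop (g : 'M[C]_n) : g *m J *m g^T = J -> forall j,
  ext_sym2_act g (loop J x j) = loop J x j.
Proof.
move=> gJg j; rewrite /loop linear_sum.
transitivity (\sum_a \sum_b \sum_c \sum_d (J a b * (g c a * g d b)) *: arc_mx J x j c d).
  apply: eq_bigr => a _; rewrite linear_sum; apply: eq_bigr => b _.
  rewrite linearZ /=; have := congr1 (fun M : 'M_n => M a b) (act_arc_mx gJg j).
  rewrite [LHS]mxE => ->; rewrite conjugate_coef scaler_sumr; apply: eq_bigr => c _.
  by rewrite scaler_sumr; apply: eq_bigr => d _; rewrite scalerA.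
transitivity (\sum_c \sum_d \sum_b \sum_a (J a b * (g c a * g d b)) *: arc_mx J x j c d).
  by rewrite sum4_rev exchange_big.
apply: eq_bigr => c _; apply: eq_bigr => d _.
under eq_bigr do rewrite -scaler_suml.
rewrite -scaler_suml; congr (_ *: _); rewrite -[in RHS]gJg mxE.
apply: eq_bigr => b _; rewrite !mxE mulr_suml; apply: eq_bigr => a _.
by rewrite mulrCA mulrA.
Qed.

End Invariance.

Section TopForm.

Context (C : numClosedFieldType) (n : nat) (J : 'M[C]_n).
Hypothesis Jalt : J^T = - J.

Lemma ext_det_sym2_mul (g h : 'M[C]_n) :
  ext_det (sym2_act (g *m h)) = ext_det (sym2_act g) * ext_det (sym2_act h).
Proof. by rewrite -ext_det_comp; apply: eq_ext_det; apply: sym2_act_comp. Qed.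

Lemma ext_det_sym2_1 : ext_det (sym2_act (1%:M : 'M[C]_n)) = 1.
Proof. by rewrite -[RHS](ext_det_id (sym2 C n)); apply: eq_ext_det => u; apply: sym2_act1. Qed.

Lemma ext_det_sym2_unit (g h : 'M[C]_n) : g *m h = 1%:M -> ext_det (sym2_act g) != 0.
Proof.
move=> gh; apply/eqP => g0; have := ext_det_sym2_1.
by rewrite -gh ext_det_sym2_mul g0 mul0r => /eqP; rewrite eq_sym oner_eq0.
Qed.

(** The transvection 1 + t N, where N^2 = 0, is conjugate to 1 + 2 t N, its
    square, so its determinant D on the top form satisfies D = D^2. *)
Lemma ext_det_transvection t v : ext_det (sym2_act (transvection J t v)) = 1.
Proof.
have [->|v0] := eqVneq v 0.
  by rewrite /transvection mulmx0 mul0mx scaler0 addr0 ext_det_sym2_1.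
have [i vi] : exists i, v 0 i != 0.
  apply/existsP; apply: contraNT v0; rewrite negb_exists => /forallP v0.
  by apply/eqP/rowP => i; rewrite mxE; have := v0 i; rewrite negbK => /eqP.
have [u uv] : exists u : 'rV[C]_n, u *m v^T = 1%:M.
  exists ((v 0 i)^-1 *: delta_mx 0 i); rewrite -scalemxAl -rowE.
  by apply/matrixP => a b; rewrite !ord1 !mxE mulVf.
(* h doubles v^T and fixes the linear form v J, which vanishes on v^T. *)
pose h : 'M[C]_n := 1%:M + v^T *m u.
have sq : v^T *m u *m (v^T *m u) = v^T *m u.
  by rewrite mulmxA -[_ *m v^T]mulmxA uv mulmx1.
have h_unit : h *m (1%:M - 2%:R^-1 *: (v^T *m u)) = 1%:M.
  rewrite mulmxBr mulmx1 -scalemxAr mulmxDl mul1mx sq.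
  rewrite -mulr2n -scaler_nat scalerA mulVf ?pnatr_eq0 //.
  by rewrite scale1r addrK.
have conj_h : h *m transvection J t v = transvection J (t + t) v *m h.
  rewrite /transvection /h !mulmxDl !mulmxDr !mul1mx !mulmx1 -!scalemxAr -!scalemxAl.
  have -> : v^T *m u *m (v^T *m v *m J) = v^T *m v *m J.
    by rewrite !mulmxA -[_ *m v^T]mulmxA uv mulmx1.
  have -> : v^T *m v *m J *m (v^T *m u) = 0.
    have -> : v^T *m v *m J *m (v^T *m u) = v^T *m (v *m J *m v^T) *m u by rewrite !mulmxA.
    by rewrite (alt_form Jalt) mulmx0 mul0mx.
  by rewrite scaler0 addr0; apply/matrixP => a b; rewrite !mxE; ring.
have D0 := ext_det_sym2_unit h_unit.
have Dt0 : ext_det (sym2_act (transvection J t v)) != 0.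
  apply: (@ext_det_sym2_unit _ (transvection J (- t) v)).
  by rewrite transvectionD // subrr transvection0.
have Dconj : ext_det (sym2_act h) * ext_det (sym2_act (transvection J t v)) =
    ext_det (sym2_act (transvection J (t + t) v)) * ext_det (sym2_act h).
  by rewrite -!ext_det_sym2_mul conj_h.
have Dsqr : ext_det (sym2_act (transvection J (t + t) v)) =
    ext_det (sym2_act (transvection J t v)) * ext_det (sym2_act (transvection J t v)).
  by rewrite -ext_det_sym2_mul transvectionD.
move: Dconj; rewrite Dsqr; move: D0 Dt0.
move: (ext_det (sym2_act h)) (ext_det (sym2_act (transvection J t v))) => dh dt dh0 dt0 E.
by apply: (mulfI dt0); apply: (mulIf dh0); rewrite mulr1 -E mulrC.
Qed.

Lemma transvection_top t v :
  ext_sym2_act (transvection J t v) (ext_top (sym2 C n)) = ext_top (sym2 C n).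
Proof. by rewrite [LHS]ext_map_top ext_det_transvection scale1r. Qed.

End TopForm.

Section Invariants.

Context (C : numClosedFieldType) (k : nat).
Local Notation n := (k + k)%N.
Local Notation J := (symplectic_form C k).
Local Notation U := (sym2 C n).
Local Notation W := (exterior U).
Local Notation x := (gen_mx C n).

Let Jalt := symplectic_form_alt C k.
Let JJ := symplectic_form_sqr C k.
Let char0 m : (0 < m)%N -> m%:R != 0 :> C.
Proof. by rewrite pnatr_eq0 -lt0n. Qed.

Definition prim (i : 'I_k) : W := loop J x (4 * i + 2).
Definition prim_deg (i : 'I_k) : nat := (4 * i + 3)%N.

Lemma prim_power i : prim i \in ext_power U (prim_deg i).
Proof.
have -> : prim_deg i = (4 * i + 2).+1 by rewrite /prim_deg; lia.
by apply: loop_power; apply: gen_mx_deg1.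
Qed.

Lemma prim_sqr i : prim i * prim i = 0.
Proof.
have := ext_supercomm (prim_power i) (prim_power i).
rewrite -signr_odd oddM /prim_deg oddD oddM /= expr1 scaleN1r => /eqP.
rewrite -addr_eq0 -mulr2n -scaler_nat scaler_eq0 (negPf (char0 (isT : 0 < 2)%N)).
by move/eqP.
Qed.

(** j must be even by loop_odd, equal to 2 or 3 mod 4 by loop_even_bin, and less
    than 4k by arc_mx_vanish. *)
Lemma loop_eq0 j : (forall i : 'I_k, j != 4 * i + 2)%N -> loop J x j = 0.
Proof.
move=> jn; have [/loop_odd|ej] := boolP (odd j).
  by apply=> //; apply: gen_mx_deg1.
have [ob|/loop_even_bin] := boolP (odd 'C(j, 2)); last first.
  by apply=> //; [apply: gen_mx_deg1 | apply: gen_mx_sym].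
have [lejn|ltjn] := leqP (2 * n) j.
  rewrite /loop arc_mx_vanish //; [|exact: gen_mx_deg1|exact: gen_mx_sym].
  by rewrite big1 // => a _; rewrite big1 // => b _; rewrite [X in _ *: X]mxE scaler0.
have j4 : (j = 4 * (j %/ 4) + 2)%N.
  move: ob; rewrite bin2; have := odd_double_half j; rewrite (negPf ej) add0n => <-.
  move: (j./2) => m; rewrite -doubleMl doubleK oddM; have := odd_double_half m.
  case: (odd m) => //= <- _. rewrite -!muln2; lia.
have ltk : (j %/ 4 < k)%N by lia.
by have := jn (Ordinal ltk); rewrite /= -j4 eqxx.
Qed.

Local Notation P := (set_span prim prim_deg).

(** Lift v to an invariant tensor and contract: the loops that occur are zero or
    one of the elements prim i. *)
Lemma transvection_invariant_span d v : (0 < k)%N -> v \in ext_power U d ->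
    (forall t r, ext_sym2_act (transvection J t r) v = v) -> v \in P d.
Proof.
move=> k0 vd inv; have [T0 vT0] := tens_to_ext_surj vd.
have [T TT0 Tinv] := @invariant_lift _ _ _ _ (@tens_to_ext C n d) (@ext_sym2_act C n)
  (@tens_to_ext_lin C n d) (fun g => linear0 _) (@tens_to_ext_act C n d) T0.
have kT : sp_killed J setT T.
  by apply: transvections_sp_killed => t r w; apply: Tinv; rewrite -vT0; apply: inv.
pose s := [seq (0%N, (l, false), (l, true)) | l <- index_enum 'I_d].
have sE : arc_eval J x s T = v.
  rewrite vT0 -TT0 /arc_eval /tens_to_ext; apply: eq_bigr => w _; congr (_ *: _).
  by rewrite /arc_prod big_map.
have sd : arc_deg s = d.
  by rewrite /arc_deg big_map /= sum_nat_const card_ord muln1.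
have sNames : arc_names s = [seq (l, b) | l <- index_enum 'I_d, b <- [:: false; true]].
  by rewrite /arc_names /s -map_comp; congr flatten; apply: eq_map.
have P1 : 1 \in P 0%N.
  have := set_prod_span prim prim_deg set0.
  by rewrite /set_prod enum_set0 big_nil /set_deg big_set0.
have Ploop a e y : y \in P e -> loop J x a * y \in P (a.+1 + e)%N.
  move=> ye; have [/existsP[i /eqP ->]|] := boolP [exists i : 'I_k, a == 4 * i + 2]%N.
    have -> : ((4 * i + 2).+1 + e = prim_deg i + e)%N by rewrite /prim_deg; lia.
    exact: mul_set_span prim_power prim_sqr _ _ _ ye.
  by rewrite negb_exists => /forallP an; rewrite loop_eq0 ?mul0r ?mem0v.
have n0 : (0 < n)%N by rewrite addn_gt0 k0.
have us : uniq (arc_names s).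
  by rewrite sNames allpairs_uniq ?index_enum_uniq // => -[l b] [l' b'] _ _ [-> ->].
have ms p : p \in arc_names s.
  case: p => l b; rewrite sNames; apply/allpairsP; exists (l, b).
  by rewrite mem_index_enum; case: b.
have := arc_eval_invariant (@gen_mx_deg1 C n) Jalt JJ (gen_mx_sym C n) P1 Ploop n0 kT us ms.
by rewrite sd sE.
Qed.

Lemma act_prim (g : 'M[C]_n) i : g \in Sp C k -> ext_sym2_act g (prim i) = prim i.
Proof. by move=> /sp_trmx gJg; apply: act_loop. Qed.

Lemma act_set_prod (g : 'M[C]_n) A : g \in Sp C k ->
  ext_sym2_act g (set_prod prim A) = set_prod prim A.
Proof.
move=> gS; rewrite /ext_sym2_act /set_prod ext_map_prod.
by apply: eq_bigr => i _; apply: act_prim.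
Qed.

Lemma prim_deg_total : set_deg prim_deg setT = \dim {:U}.
Proof.
have -> : set_deg prim_deg setT = (\sum_(i < k) (4 * i + 3))%N.
  by apply: eq_bigl => i; rewrite inE.
rewrite dim_sym2; elim: k => [|m IHm]; first by rewrite big_ord0.
rewrite big_ord_recr /= IHm addSn (addnS m m) [in RHS]binS bin1 [in RHS]binS bin1.
lia.
Qed.

(** The top form is invariant of degree prim_deg_total, so it lies in the span
    of the products of that degree; the only one is the full product. *)
Lemma prim_full_neq0 : (0 < k)%N -> set_prod prim setT != 0.
Proof.
move=> k0.
have topP : ext_top U \in P (set_deg prim_deg setT).
  apply: transvection_invariant_span => // [|t r].
    by rewrite prim_deg_total ext_top_power.
  exact: transvection_top.
apply/eqP => full0; have : (ext_top U : W) != 0.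
  by apply/eqP => /ffunP /(_ setT); rewrite ext_top_coord ffunE => /eqP; rewrite oner_eq0.
case/negP; rewrite -memv0; apply: subvP topP; apply/span_subvP => _ /mapP[A + ->].
rewrite mem_enum inE memv0 => /eqP dA; suff -> : A = setT by rewrite full0.
apply/eqP; rewrite -subTset; apply/subsetP => i _; apply: contraT => iA.
move: dA; rewrite {2}/set_deg (bigID (mem A)) /= => dA.
have : (\sum_(j in setT | j \notin A) prim_deg j = 0)%N.
  apply/eqP; rewrite -(eqn_add2l (set_deg prim_deg A)) addn0 {2}dA /set_deg.
  by rewrite eqn_add2r; apply/eqP; apply: eq_bigl => j; rewrite inE.
rewrite (bigD1 i) /= ?inE //; rewrite {1}/prim_deg; lia.
Qed.

Lemma dim_invariants d : (0 < k)%N ->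
  \dim (invariants (Sp C k) d) = #|[set A : {set 'I_k} | set_deg prim_deg A == d]|.
Proof.
move=> k0; rewrite -(dim_set_span prim_power prim_sqr (prim_full_neq0 k0)).
congr (\dim _); apply/vspaceP => v; apply/idP/idP.
  move=> /invariantsP[vd vinv]; apply: transvection_invariant_span => // t r.
  by apply: vinv; rewrite inE transvection_unit //= transvection_sp.
move=> vP; apply/invariantsP; split; first exact: set_span_power prim_power _ _ vP.
move=> g gS; move: vP; rewrite /set_span; set X := map _ _ => vX.
rewrite (coord_span (X := in_tuple X) vX) linear_sum; apply: eq_bigr => l _.
rewrite linearZ /=; congr (_ *: _).
have : (in_tuple X)`_l \in X by apply: mem_nth.
by case/mapP => A _ ->; apply: act_set_prod.
Qed.

Lemma hilbert_series_sp : (0 < k)%N ->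
  hilbert_series (Sp C k) = \sum_(A : {set 'I_k}) 'X^(set_deg prim_deg A).
Proof.
move=> k0; apply/polyP => d; rewrite coef_hilbert_series dim_invariants // coef_sum.
under eq_bigr do rewrite coefXn eq_sym.
rewrite -sum1_card -[LHS]natz natr_sum big_mkcond; apply: eq_bigr => A _.
by rewrite inE; case: eqP.
Qed.

End Invariants.

(** * Counting: the q-binomial theorem *)

Section QBinomial.

Context (R : comNzRingType) (q : R).

(** The Gaussian binomial coefficient of m + M over m, as the generating
    function of partitions with at most M parts, all at most m; v is the
    multiplicity of the part m. *)
Fixpoint qbox (m M : nat) : R :=
  if m is m'.+1 then \sum_(v < M.+1) q ^+ (m * v) * qbox m' (M - v) else 1.

Lemma qbox0 m : qbox m 0 = 1.
Proof. by elim: m => //= m IHm; rewrite big_ord1 muln0 mul1r IHm. Qed.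

(** Either the part m+1 does not occur, or one copy of it is removed. *)
Lemma qboxS m M : qbox m.+1 M.+1 = qbox m M.+1 + q ^+ m.+1 * qbox m.+1 M.
Proof.
rewrite [LHS]/= big_ord_recl muln0 mul1r subn0; congr (_ + _).
rewrite [qbox m.+1 M]/= mulr_sumr; apply: eq_bigr => v _.
by rewrite subSS mulrA -exprD mulnS.
Qed.

(** The variable z is general because the induction splits off the factor
    i = 0, which replaces z by z q in the other factors. *)
Lemma q_binomial k (z : R) :
  \prod_(i < k) (1 + z * q ^+ i) = \sum_(m < k.+1) z ^+ m * q ^+ 'C(m, 2) * qbox m (k - m).
Proof.
elim: k z => [|k IHk] z; first by rewrite big_ord0 big_ord1 /= !mulr1.
rewrite big_ord_recl mulr1.
under eq_bigr do rewrite exprS mulrA.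
rewrite IHk mulrDl mul1r.
rewrite [X in X + _](eq_bigr (fun m : 'I_k.+1 =>
    z ^+ m * q ^+ 'C(m, 2) * (q ^+ m * qbox m (k - m)))); last first.
  by move=> m _; rewrite exprMn; ring.
rewrite mulr_sumr [X in _ + X](eq_bigr (fun m : 'I_k.+1 =>
    z ^+ m.+1 * q ^+ 'C(m.+1, 2) * qbox m (k - m))); last first.
  by move=> m _; rewrite exprMn binS bin1 exprD exprS; ring.
rewrite big_ord_recl [X in _ + X]big_ord_recr [RHS]big_ord_recl /=.
rewrite !mul1r -addrA; congr (_ + _); rewrite big_ord_recr /= addrA.
rewrite !subnn !qbox0; congr (_ + _).
rewrite -big_split; apply: eq_bigr => m _ /=.
rewrite !/bump !add1n -mulrDr; congr (_ * _).
have -> : (k.+1 - m.+1 = (k - m.+1).+1)%N by have := ltn_ord m; lia.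
have -> : (k - m = (k - m.+1).+1)%N by have := ltn_ord m; lia.
by rewrite addrC; apply/esym/qboxS.
by rewrite big_ord1 muln0 expr0 !mulr1.
Qed.

End QBinomial.

Lemma big_ffun_recr (R : nmodType) (T : finType) m (F : {ffun 'I_m.+1 -> T} -> R) :
  \sum_f F f = \sum_t \sum_(g : {ffun 'I_m -> T})
     F [ffun i => if unlift ord_max i is Some j then g j else t].
Proof.
rewrite pair_bigA /=.
pose enc (p : T * {ffun 'I_m -> T}) : {ffun 'I_m.+1 -> T} :=
  [ffun i => if unlift ord_max i is Some j then p.2 j else p.1].
rewrite (reindex enc) //=.
exists (fun f => (f ord_max, [ffun j => f (lift ord_max j)])) => [[t g] _|f _].
  rewrite /enc ffunE unlift_none; congr (_, _); apply/ffunP => j.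
  by rewrite !ffunE liftK.
by apply/ffunP => i; rewrite ffunE; case: unliftP => [j ->|->] //=; rewrite ffunE.
Qed.

(** Half of the entry a_i is the multiplicity of the part i+1 in a partition. *)
Lemma even_tuples_qbox m M N : (2 * M <= N)%N ->
  \sum_(a : {ffun 'I_m -> 'I_N.+1} |
      [forall i, ~~ odd (a i)] && (\sum_i a i <= 2 * M)%N)
    'X^(\sum_(i < m) 2 * i.+1 * a i) = qbox ('X^4 : {poly int}) m M.
Proof.
elim: m M => [|m IHm] M leMN.
  rewrite big_mkcond (big_pred1 [ffun=> ord0]) /=; last first.
    by move=> a; apply/esym/eqP/ffunP => -[].
  by rewrite !big_ord0 leq0n andbT; case: forallP => [_|[]] //; case.
rewrite big_mkcond big_ffun_recr /=.
pose G t (g : {ffun 'I_m -> 'I_N.+1}) : {poly int} :=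
  if [&& ~~ odd t, [forall i, ~~ odd (g i)] & t + \sum_i g i <= 2 * M]%N then
    'X^(2 * m.+1 * t) * 'X^(\sum_(i < m) 2 * i.+1 * g i) else 0.
transitivity (\sum_(t < N.+1) \sum_g G t g).
  apply: eq_bigr => t _; apply: eq_bigr => g _; set f := [ffun i => _].
  have fl (i : 'I_m) : f (widen_ord (leqnSn m) i) = g i.
    rewrite ffunE (_ : widen_ord _ i = lift ord_max i) ?liftK //.
    by apply/val_inj/esym/lift_max.
  have fm : f ord_max = t by rewrite ffunE unlift_none.
  rewrite !big_ord_recr /= fm; under eq_bigr do rewrite fl.
  under [in 'X^_]eq_bigr do rewrite fl.
  have -> : [forall i, ~~ odd (f i)] = ~~ odd t && [forall i, ~~ odd (g i)].
    apply/forallP/andP => [fe|[te /forallP ge] i].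
      split; first by have := fe ord_max; rewrite fm.
      by apply/forallP => i; rewrite -fl.
    by rewrite ffunE; case: unliftP => [j _|_].
  by rewrite /G -andbA addnC exprD mulrC.
rewrite (bigID (fun t : 'I_N.+1 => ~~ odd t && (t <= 2 * M)%N)) /= [X in _ + X]big1 ?addr0; last first.
  move=> t; rewrite negb_and => tb; rewrite big1 // => g _; rewrite /G.
  case/orP: tb => [/negPf -> //|tM]; case: ifP => // /and3P[_ _ H].
  by case/negP: tM; apply: leq_trans H; apply: leq_addr.
rewrite (reindex_onto (fun v : 'I_M.+1 => inord (2 * v) : 'I_N.+1) (fun t => inord t./2)); last first.
  move=> t /andP[te tM]; apply: val_inj; have := odd_double_half t.
  rewrite (negPf te) add0n => th; rewrite /= !inordK; lia.
have vN (v : 'I_M.+1) : (inord (2 * v) : 'I_N.+1) = (2 * v)%N :> nat.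
  by rewrite inordK //; have := ltn_ord v; lia.
apply: eq_big => [v|v _].
  rewrite vN mul2n odd_double /= doubleK inord_val eqxx andbT.
  by have := ltn_ord v; lia.
have leMv : (2 * (M - v) <= N)%N by lia.
rewrite -(IHm _ leMv) [in RHS]big_mkcond mulr_sumr; apply: eq_bigr => g _.
rewrite /G vN mul2n odd_double /=.
have -> : (v.*2 + \sum_i g i <= 2 * M)%N = (\sum_i g i <= 2 * (M - v))%N.
  have := ltn_ord v; move: (\sum_i g i)%N => s; lia.
case: ifP => _; last by rewrite mulr0.
by congr (_ * _); rewrite -exprM; congr ('X^_); lia.
Qed.

Lemma sum_even_nat (R : nmodType) k (F : nat -> R) :
  \sum_(2 <= p < (k + k).+1 | ~~ odd p) F p = \sum_(1 <= m < k.+1) F (2 * m)%N.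
Proof.
elim: k => [|k IHk]; first by rewrite !big_geq.
rewrite addSn addnS.
case: k IHk => [|k] IHk.
  by rewrite [RHS]big_nat1 big_mkcond big_nat1.
rewrite big_mkcond big_nat_recr //= big_nat_recr //= -big_mkcond IHk.
rewrite [RHS]big_nat_recr //=.
have -> : odd (k + k.+1) by rewrite addnS /= oddD addbb.
by rewrite /= addr0; congr (_ + F _); lia.
Qed.

(** Sum over subsets first: the left-hand side is the product of the
    1 + X^3 (X^4)^i, to which q_binomial applies with z = X^3 and q = X^4; the
    term for p = 2m has exponent 3m + 4 m(m-1)/2 = p(p+1)/2. *)
Theorem sum_subsets_even_tuples k : let n := (k + k)%N in
  \sum_(A : {set 'I_k}) 'X^(\sum_(i in A) (4 * i + 3))%N =
  1 + \sum_(2 <= p < n.+1 | ~~ odd p)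
        'X^((p * p.+1) %/ 2) *
        \sum_(a : {ffun 'I_(p %/ 2) -> 'I_(n - p).+1} |
                [forall i, ~~ odd (a i)] && (\sum_i a i <= n - p)%N)
          'X^(\sum_(i < p %/ 2) 2 * i.+1 * a i) :> {poly int}.
Proof.
move=> n; rewrite sum_even_nat.
transitivity (\prod_(i < k) (1 + 'X^3 * ('X^4) ^+ i) : {poly int}).
  under [RHS]eq_bigr do rewrite addrC.
  rewrite bigA_distr /=; apply: eq_bigr => A _.
  rewrite -big_mkcond /= (big_morph (fun e => 'X^e : {poly int}) (exprD _) (expr0 _)).
  by apply: eq_bigr => i _; rewrite -exprM -exprD addnC.
rewrite q_binomial big_ord_recl /= !mulr1; congr (_ + _).
rewrite big_add1 /= big_mkord; apply: eq_bigr => m _; rewrite /bump add1n.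
rewrite mulKn //; have := ltn_ord m; set M := m.+1 => ltm.
have nM : (n - 2 * M = 2 * (k - M))%N by rewrite /n; lia.
rewrite nM even_tuples_qbox //; congr (_ * _).
rewrite -!exprM -exprD; congr ('X^_).
have -> : (2 * M * (2 * M).+1 = 2 * (M * (2 * M).+1))%N by lia.
rewrite mulKn //; have : ('C(M, 2) * 2 + M = M * M)%N.
  by rewrite /M; elim: (nat_of_ord m) => [//|j IHj]; rewrite binS bin1; lia.
nia.
Qed.

(** * The Hilbert series *)

Local Open Scope complex_scope.

Theorem proposition6p2 (R : realType) (k : nat) (hk : (1 <= k)%N) :
  let n := (k + k)%N in
  hilbert_series (Sp R[i] k) =
  1 + \sum_(2 <= p < n.+1 | ~~ odd p)
        'X^((p * p.+1) %/ 2) *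
        \sum_(a : {ffun 'I_(p %/ 2) -> 'I_(n - p).+1} |
                [forall i, ~~ odd (a i)] && (\sum_i a i <= n - p)%N)
          'X^(\sum_(i < p %/ 2) 2 * i.+1 * a i) :> {poly int}.
Proof.
move=> n; have := sum_subsets_even_tuples k; rewrite /= -/n => <-.
exact: (@hilbert_series_sp R[i] k hk).
Qed.
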